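(* Let $(\mathcal{M},\tau)$ be a finite von Neumann algebra with separable predual (with $\tau$ a faithful normal tracial state). Then the collection of amenable von Neumann subalgebras of $\mathcal{M}$ is closed in $\mathrm{SA}(\mathcal{M})$ with respect to the Effros–Maréchal topology.
   Context: For a von Neumann algebra $\mathcal{M}$ with separable predual, $\mathrm{SA}(\mathcal{M})$ is the set of all (unital) von Neumann subalgebras of $\mathcal{M}$, equipped with the Effros–Maréchal topology, which is a separable (completely) metrizable topology determined by its convergent sequences: for $\mathcal{M}_n\in\mathrm{SA}(\mathcal{M})$, let $\liminf_n\mathcal{M}_n$ be the set of $x\in\mathcal{M}$ for which there is a norm-bounded sequence $x_n\in\mathcal{M}_n$ converging to $x$ in the strong-$*$ operator topology, and let $\limsup_n\mathcal{M}_n$ be the von Neumann algebra generated by all $x\in\mathcal{M}$ for which there is a norm-bounded sequence $x_n\in\mathcal{M}_n$ having $x$ as a weak-operator limit point. Then $\mathcal{M}_n\to\tilde{\mathcal{M}}$ iff $\liminf_n\mathcal{M}_n=\limsup_n\mathcal{M}_n=\tilde{\mathcal{M}}$. A tracial von Neumann algebra $(\mathcal{N},\tau)$, $\mathcal{N}\subseteq\mathbb{B}(\mathcal{H})$ with $\mathcal{H}$ separable, is amenable if there is a state $\phi$ on $\mathbb{B}(\mathcal{H})$ with $\phi|_{\mathcal{N}}=\tau$ and $\phi(Tm)=\phi(mT)$ for all $m\in\mathcal{N}$, $T\in\mathbb{B}(\mathcal{H})$; subalgebras of $\mathcal{M}$ carry the restricted trace. *)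

(* Defs.v *)
From HB Require Import structures.
From mathcomp Require Import all_boot all_order all_algebra.
From mathcomp Require Import complex.
From mathcomp Require Import all_classical all_reals all_analysis.

Set Implicit Arguments.
Unset Strict Implicit.
Unset Printing Implicit Defensive.

Import Order.TTheory GRing.Theory Num.Theory Num.Def.
Import numFieldNormedType.Exports.

Local Open Scope classical_set_scope.
Local Open Scope ring_scope.

(* The norm of [H] takes its values in [R[i]]; inner products are linear in
   the first argument. *)
HB.mixin Record isHilbert (R : realType) H
    of CompleteNormedModule R[i] H := {
  inner : {dot H for (@conjC R[i])} ;
  inner_norm : forall x : H, inner x x = `|x| ^+ 2
}.

#[short(type="hilbertType")]
HB.structure Definition Hilbert (R : realType) :=
  {H of isHilbert R H & CompleteNormedModule R[i] H}.

Definition separable (T : topologicalType) : Prop :=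
  exists D : set T, countable D /\ dense D.

Section BoundedOperators.
Context {R : realType} (H : hilbertType R).

Definition bounded_op : {pred (H -> H)} :=
  fun f => `[< linear f /\ continuous f >].

Lemma bounded_op_submod_closed : submod_closed bounded_op.
Proof.
split=> [|a f g /asboolP[lf cf] /asboolP[lg cg]]; apply/asboolP; split.
- by move=> c x y; rewrite /= [in RHS]scaler0 addr0.
- exact: cst_continuous.
- move=> c x y; rewrite !fctE lf lg scalerDr [in RHS]scalerDr !scalerA.
  by rewrite (mulrC a c) addrACA.
- move=> x; apply: cvgD; last exact: cg.
  by apply: cvgZl_tmp; exact: cf.
Qed.

HB.instance Definition _ :=
  GRing.isSubmodClosed.Build R[i] (H -> H) bounded_op bounded_op_submod_closed.

Record bop := Bop { bop_fun :> H -> H ; bop_funP : bop_fun \in bounded_op }.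

HB.instance Definition _ := [isSub for bop_fun].
HB.instance Definition _ := [Choice of bop by <:].
HB.instance Definition _ := [SubChoice_isSubLmodule of bop by <:].

Lemma id_bounded_op : (idfun : H -> H) \in bounded_op.
Proof. by apply/asboolP; split=> // x; exact: cvg_id. Qed.

Lemma comp_bounded_op (S T : bop) : (S \o T : H -> H) \in bounded_op.
Proof.
have /asboolP[lf cf] := bop_funP S; have /asboolP[lg cg] := bop_funP T.
apply/asboolP; split.
  by move=> c x y /=; rewrite lg lf.
by move=> x; apply: continuous_comp; [exact: cg|exact: cf].
Qed.

Definition id_bop : bop := Bop id_bounded_op.
Definition comp_bop (S T : bop) : bop := Bop (comp_bounded_op S T).

Lemma comp_bopA : associative comp_bop.
Proof. by move=> S T U; exact: val_inj. Qed.

Lemma comp_id_bop : left_id id_bop comp_bop.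
Proof. by move=> S; exact: val_inj. Qed.

Lemma comp_bop_id : right_id id_bop comp_bop.
Proof. by move=> S; exact: val_inj. Qed.

Lemma comp_bopDl : left_distributive comp_bop +%R.
Proof. by move=> S T U; exact: val_inj. Qed.

Lemma comp_bopDr : right_distributive comp_bop +%R.
Proof.
move=> S T U; apply: val_inj; apply/funext => x /=.
by have /asboolP[lf _] := bop_funP S; have := lf 1 (T x) (U x); rewrite !scale1r.
Qed.

HB.instance Definition _ := GRing.Zmodule_isPzRing.Build bop
  comp_bopA comp_id_bop comp_bop_id comp_bopDl comp_bopDr.

(* The set on the right is a singleton, by the Riesz representation theorem;
   the default value 0 is never used. *)
Definition adj (T : bop) : bop :=
  xget 0 [set S : bop | forall x y, inner (T x) y = inner x (S y)].

Definition wot_map (T : bop) : {ptws (H * H)%type -> R[i]^o} :=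
  fun p => inner (T p.1) p.2.

(* B(H) with the weak operator topology *)
Definition wot : Type := initial_topology wot_map.
HB.instance Definition _ := Topological.on wot.

Definition l2seq (x : nat -> H) : Prop :=
  cvgn (series (fun n => `|x n| ^+ 2) : nat -> R[i]^o).

Definition l2pair : Type :=
  {p : (nat -> H) * (nat -> H) | l2seq p.1 /\ l2seq p.2}.

Definition uwot_map (T : bop) : {ptws l2pair -> R[i]^o} :=
  fun p => limn (series (fun n => inner (T ((sval p).1 n)) ((sval p).2 n))
                   : nat -> R[i]^o).

(* B(H) with the ultraweak (sigma-weak) topology *)
Definition uwot : Type := initial_topology uwot_map.
HB.instance Definition _ := Topological.on uwot.

Definition norm_bounded (T_ : nat -> bop) : Prop :=
  exists C : R[i], forall n x, `|T_ n x| <= C * `|x|.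

Definition strong_star_cvg (T_ : nat -> bop) (T : bop) : Prop :=
  forall x : H, (fun n => T_ n x) @ \oo --> T x /\
                (fun n => adj (T_ n) x) @ \oo --> adj T x.

Definition weak_limit_point (T_ : nat -> bop) (T : bop) : Prop :=
  cluster ((T_ : nat -> wot) @ \oo) (T : wot).

End BoundedOperators.

Section VonNeumannAlgebras.
Context {R : realType} {H : hilbertType R}.
Implicit Types (M N S : set (bop H)).

Record von_neumann M : Prop := {
  von_neumann1 : M 1 ;
  von_neumann_lin : forall (a : R[i]) x y, M x -> M y -> M (a *: x + y) ;
  von_neumannM : forall x y, M x -> M y -> M (x * y) ;
  von_neumann_adj : forall x, M x -> M (adj x) ;
  von_neumann_closed : closed (M : set (wot H))
}.

Definition vn_generated S : set (bop H) :=
  [set x | forall N, von_neumann N -> S `<=` N -> N x].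

(* [tau] is a functional on [M]: its values outside [M] play no role.
   Normality is ultraweak continuity, i.e. [tau] is in the predual of [M]. *)
Record faithful_normal_tracial_state M (tau : bop H -> R[i]^o) : Prop := {
  tau_lin : forall (a : R[i]) x y, M x -> M y ->
    tau (a *: x + y) = a * tau x + tau y ;
  tau_ge0 : forall x, M x -> 0 <= tau (adj x * x) ;
  tau1 : tau 1 = 1 ;
  tau_tracial : forall x y, M x -> M y -> tau (x * y) = tau (y * x) ;
  tau_faithful : forall x, M x -> tau (adj x * x) = 0 -> x = 0 ;
  tau_normal : {within (M : set (uwot H)), continuous (tau : uwot H -> R[i]^o)}
}.

Definition is_state (phi : {linear bop H -> R[i]^o}) : Prop :=
  (forall T : bop H, 0 <= phi (adj T * T)) /\ phi 1 = 1.

Definition amenable (tau : bop H -> R[i]^o) N : Prop :=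
  exists phi : {linear bop H -> R[i]^o},
    [/\ is_state phi,
        forall m, N m -> phi m = tau m &
        forall m T, N m -> phi (T * m) = phi (m * T)].

Record SA M := MkSA {
  SA_set :> set (bop H) ;
  SA_von_neumann : von_neumann SA_set ;
  SA_sub : SA_set `<=` M
}.

End VonNeumannAlgebras.

Section EffrosMarechal.
Context {R : realType} {H : hilbertType R} (M : set (bop H)).

Definition liminf_SA (N_ : nat -> SA M) : set (bop H) :=
  [set x | M x /\ exists x_ : nat -> bop H,
    [/\ forall n, SA_set (N_ n) (x_ n), norm_bounded x_ & strong_star_cvg x_ x]].

Definition limsup_SA (N_ : nat -> SA M) : set (bop H) :=
  vn_generated [set x | M x /\ exists x_ : nat -> bop H,
    [/\ forall n, SA_set (N_ n) (x_ n), norm_bounded x_ & weak_limit_point x_ x]].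

Definition EM_cvg (N_ : nat -> SA M) (N : SA M) : Prop :=
  liminf_SA N_ = N /\ limsup_SA N_ = N.

HB.instance Definition _ := gen_eqMixin (SA M).
HB.instance Definition _ := gen_choiceMixin (SA M).

(* A metrizable topology is determined by its convergent sequences: its open
   sets are the sequentially open ones. *)
Definition EM_open : set_system (SA M) :=
  [set U | forall (N_ : nat -> SA M) N, U N -> EM_cvg N_ N ->
    \forall n \near \oo, U (N_ n)].

Lemma EM_openT : EM_open setT.
Proof. by move=> N_ N _ _; exact: nearW. Qed.

Lemma EM_openI : setI_closed EM_open.
Proof.
move=> U V oU oV N_ N [UN VN] cN.
by apply: filterI; [exact: oU cN|exact: oV cN].
Qed.

Lemma EM_open_bigU (I : Type) (U : I -> set (SA M)) :
  (forall i, EM_open (U i)) -> EM_open (\bigcup_i U i).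
Proof.
move=> oU N_ N [i _ UN] cN.
by apply: filterS (oU i N_ N UN cN) => n Un; exists i.
Qed.

HB.instance Definition _ :=
  isOpenTopological.Build (SA M) EM_openT EM_openI EM_open_bigU.

End EffrosMarechal.

(* Main.v *)
(* Idea.  Let [N_n] be amenable and [N_n -> N].  A hypertrace [phi_n] of [N_n]
   knows nothing about elements of [M] outside [N_n], so it is first replaced by
   an [N_n]-central state [psi_n] of [B(H)] that restricts to [tau] on all of
   [M]; then an ultrafilter limit of the [psi_n] is a hypertrace of [N], because
   [|psi_n (T (m - m_n))|^2 <= ||T||^2 tau (|m - m_n|^2)], which tends to [0]
   when [m_n] in [N_n] is bounded and converges strongly to [m].

   [psi_n] is [phi_n o Phi], where [Phi] is an [N_n]-bimodular unital positive
   map of [B(H)] extending the [tau]-preserving conditional expectation of [M]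
   onto [N_n].  Realize [tau] as a vector state of [xi] in a multiple of the
   identity representation, [K = l2(l2(l2(H)))].  A vector [eta] of [H] with
   [||m eta|| <= ||m xi||] on [M] yields an [N_n]-modular map from [H] to the
   closure of [N_n xi]; such vectors are total, because the projection onto
   their closed span lies in [M'' = M] and its complement kills [xi].  From these
   maps one builds [N_n]-modular [V_k] with [sum_k V_k^* V_k = 1], and
   [Phi T = sum_k V_k^* T V_k].  Both [xi] and the [V_k] come out of iterating
   [t |-> t - t^2], in place of a Radon-Nikodym theorem and of polar
   decompositions. *)

(* Why [Phi] extends the expectation E of [M] onto [N]: each [V_k] takes values in the closure of
   [N xi], and the compression of x in [M] to that space acts as E(x). Modularity pulls E(x) through
   [V_k], so V_k^* x V_k = V_k^* V_k E(x), and summing over k leaves E(x). It is evaluated on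
   bounded vectors only; that it is bounded and lies in [N] is read off from [Phi x], which is
   bounded by construction. The maps are V_k = A_k Q_k, where A_k is the modular map of the k-th
   vector and Q_k is the remainder 1 - sum_(j<k) V_j^* V_j. Such a step removes only a fraction of
   the remainder, so every vector is used infinitely often to make Q_k tend weakly to 0. For general
   T in B(H) the sum defining [Phi] is a limit of forms along an ultrafilter. *)
Require Import Defs.
From HB Require Import structures.
From mathcomp Require Import all_boot all_order all_algebra complex.
From mathcomp Require Import all_classical all_reals all_analysis.
From mathcomp Require Import ring lra.

Set Implicit Arguments.
Unset Strict Implicit.
Unset Printing Implicit Defensive.

Import Order.TTheory GRing.Theory Num.Theory Num.Def.
Import numFieldNormedType.Exports.

Local Open Scope classical_set_scope.
Local Open Scope complex_scope.
Local Open Scope ring_scope.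

(** * Real-valued norms and limits over R[i] *)

Section RealNorm.
Context {R : realType}.
Local Notation C := R[i].

Lemma ReD (x y : C) : complex.Re (x + y) = complex.Re x + complex.Re y.
Proof. by case: x y => [? ?] []. Qed.

Lemma ImD (x y : C) : complex.Im (x + y) = complex.Im x + complex.Im y.
Proof. by case: x y => [? ?] []. Qed.

Lemma ReB (x y : C) : complex.Re (x - y) = complex.Re x - complex.Re y.
Proof. by case: x y => [? ?] []. Qed.

Lemma ReZ (a : R) (x : C) : @complex.Re R (a%:C * x) = a * complex.Re x.
Proof. by case: x => u v /=; rewrite mul0r subr0. Qed.

Lemma conjR (x : R) : (x%:C)^* = x%:C :> C.
Proof. exact: conjc_real. Qed.

Lemma ReJ (z : C) : @complex.Re R z^* = complex.Re z.
Proof. by case: z. Qed.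

(** Norms take values in [R[i]], whose order is partial; [nr] moves them to [R], where infima,
    monotone limits and [lra] are available. *)
Definition nr {V : normedZmodType C} (x : V) : R := complex.Re `|x|.

Lemma nrE (V : normedZmodType C) (x : V) : `|x| = (nr x)%:C.
Proof. by rewrite /nr RRe_real// realE normr_ge0. Qed.

Lemma nr_ge0 (V : normedZmodType C) (x : V) : 0 <= nr x.
Proof. by rewrite -ler0c -nrE normr_ge0. Qed.

Lemma nrD (V : normedZmodType C) (x y : V) : nr (x + y) <= nr x + nr y.
Proof. by rewrite -lecR rmorphD/= -!nrE ler_normD. Qed.

Lemma nrN (V : normedZmodType C) (x : V) : nr (- x) = nr x.
Proof. by rewrite /nr normrN. Qed.

Lemma nrB (V : normedZmodType C) (x y : V) : nr (x - y) <= nr x + nr y.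
Proof. by rewrite -(nrN y) nrD. Qed.

Lemma nr_dist (V : normedZmodType C) (x y : V) : nr (x - y) = nr (y - x).
Proof. by rewrite -nrN opprB. Qed.

Lemma nr0 (V : normedZmodType C) : nr (0 : V) = 0.
Proof. by rewrite /nr normr0. Qed.

Lemma nr_eq0 (V : normedZmodType C) (x : V) : (nr x == 0) = (x == 0).
Proof. by rewrite -(inj_eq (@complexI R)) -nrE normr_eq0. Qed.

Lemma nrM (x y : C) : nr (x * y) = nr x * nr y.
Proof. by apply: (@complexI R); rewrite rmorphM/= -!nrE normrM. Qed.

Lemma nrZ (V : normedModType C) (a : C) (x : V) : nr (a *: x) = nr a * nr x.
Proof. by apply: (@complexI R); rewrite rmorphM/= -!nrE normrZ. Qed.

Lemma nrR (x : R) : nr (x%:C : C) = `|x|.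
Proof.
by rewrite /nr normc_def/= expr0n addr0 sqrtr_sqr.
Qed.

Lemma nr_conj (z : C) : nr (z^* : C) = nr z.
Proof. by rewrite /nr normcJ. Qed.

Lemma Re_nr (z : C) : `|complex.Re z| <= nr z.
Proof. by rewrite -lecR -nrE normc_ge_Re. Qed.

Lemma nr_ReIm (z : C) : nr z <= `|complex.Re z| + `|complex.Im z|.
Proof.
rewrite [z in nr z]complexE (le_trans (nrD _ _))// nrM !nrR.
by rewrite /nr normc_def/= expr0n add0r expr1n sqrtr1 mul1r.
Qed.

Lemma Im_nr (z : C) : `|complex.Im z| <= nr z.
Proof.
have := Re_nr (z * 'i%C); rewrite ReiNIm normrN nrM.
by rewrite {2}/nr normc_def/= expr0n add0r expr1n sqrtr1 mulr1.
Qed.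

Lemma cvg_nrP (T : Type) (F : set_system T) {FF : Filter F}
    (V : normedModType C) (f : T -> V) (x : V) :
  f @ F --> x <-> (fun t => nr (f t - x)) @ F --> (0 : R).
Proof.
split=> [/cvgrPdist_lt h|/cvgrPdist_lt h]; apply/cvgrPdist_lt => e e0.
  have /h : 0 < (e%:C : C) by rewrite ltcR.
  apply: filterS => t; rewrite nrE ltcR sub0r normrN nr_dist => ht.
  by rewrite ger0_norm ?nr_ge0.
have eE : e = (complex.Re e)%:C by rewrite RRe_real// realE ltW.
have : 0 < complex.Re e by rewrite -ltcR -eE.
move=> /h; apply: filterS => t; rewrite sub0r normrN ger0_norm ?nr_ge0// => ht.
by rewrite nrE eE ltcR nr_dist.
Qed.

Lemma nr_squeeze (T : Type) (F : set_system T) {FF : Filter F}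
    (V : normedModType C) (f : T -> V) (x : V) (g : T -> R) :
  (\forall t \near F, nr (f t - x) <= g t) -> g @ F --> (0 : R) ->
  f @ F --> x.
Proof.
move=> fg g0; apply/cvg_nrP; apply: (@squeeze_cvgr _ _ _ _ (cst 0) g) => //.
  by apply: filterS fg => t ->; rewrite nr_ge0.
exact: cvg_cst.
Qed.

Lemma lim_uniq (T : Type) (F : set_system T) {FF : ProperFilter F}
    (V : normedModType C) (f : T -> V) (x y : V) :
  f @ F --> x -> f @ F --> y -> x = y.
Proof. by move=> fx fy; apply: (cvg_unique (@norm_hausdorff _ V) fx fy). Qed.

Lemma lim_uniqC (T : Type) (F : set_system T) {FF : ProperFilter F}
    (f : T -> C^o) (x y : C) :
  f @ F --> (x : C^o) -> f @ F --> (y : C^o) -> x = y.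
Proof. exact: lim_uniq. Qed.

Lemma cvg_nr (T : Type) (F : set_system T) {FF : Filter F}
    (V : normedModType C) (f : T -> V) (x : V) :
  f @ F --> x -> (fun t => nr (f t)) @ F --> nr x.
Proof.
move=> /cvg_nrP h; apply/cvgrPdist_le => e e0.
move/cvgrPdist_le : h => /(_ e e0); apply: filterS => t.
rewrite sub0r normrN ger0_norm ?nr_ge0// => ht.
rewrite ler_norml; apply/andP; split.
  rewrite lerNl opprB lerBlDr (le_trans _ (lerD ht (lexx _)))//.
  by rewrite (le_trans _ (nrD _ _))// subrK.
rewrite lerBlDr (le_trans _ (lerD ht (lexx _)))// nr_dist.
by rewrite (le_trans _ (nrD _ _))// subrK.
Qed.

Lemma cvg_Re (T : Type) (F : set_system T) {FF : Filter F} (f : T -> C^o) l :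
  f @ F --> (l : C^o) -> (fun t => complex.Re (f t)) @ F --> complex.Re l.
Proof.
move=> /cvg_nrP h; apply/cvgrPdist_le => e e0.
move/cvgrPdist_le : h => /(_ e e0); apply: filterS => t.
rewrite sub0r normrN ger0_norm ?nr_ge0// => ht.
by rewrite -raddfB (le_trans (Re_nr _))// nr_dist.
Qed.

Lemma cvg_Im (T : Type) (F : set_system T) {FF : Filter F} (f : T -> C^o) l :
  f @ F --> (l : C^o) -> (fun t => complex.Im (f t)) @ F --> complex.Im l.
Proof.
move=> /cvg_nrP h; apply/cvgrPdist_le => e e0.
move/cvgrPdist_le : h => /(_ e e0); apply: filterS => t.
rewrite sub0r normrN ger0_norm ?nr_ge0// => ht.
by rewrite -raddfB (le_trans (Im_nr _))// nr_dist.
Qed.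

Lemma cvg_complex (T : Type) (F : set_system T) {FF : Filter F} (f : T -> C^o) a b :
  (fun t => complex.Re (f t)) @ F --> a ->
  (fun t => complex.Im (f t)) @ F --> b -> f @ F --> (a +i* b : C^o).
Proof.
move=> fa fb.
apply: (@nr_squeeze _ _ _ _ _ _
  (fun t => `|complex.Re (f t) - a| + `|complex.Im (f t) - b|)).
  by apply: nearW => t; rewrite (le_trans (nr_ReIm _))// raddfB/= raddfB.
rewrite -[0]addr0; apply: cvgD.
  by rewrite -(normr0 R) -(subrr a); apply: cvg_norm; apply: cvgB => //; exact: cvg_cst.
by rewrite -(normr0 R) -(subrr b); apply: cvg_norm; apply: cvgB => //; exact: cvg_cst.
Qed.

Lemma cvg_conj (T : Type) (F : set_system T) {FF : Filter F} (f : T -> C^o) l :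
  f @ F --> (l : C^o) -> (fun t => (f t)^* : C^o) @ F --> (l^* : C^o).
Proof.
move=> /cvg_nrP h; apply/cvg_nrP.
by under eq_fun do rewrite -raddfB nr_conj.
Qed.

Lemma limC_ge0 (T : Type) (F : set_system T) {FF : ProperFilter F} (f : T -> C^o) (l : C) :
  (\forall t \near F, 0 <= f t) -> f @ F --> (l : C^o) -> 0 <= l.
Proof.
move=> f0 fl.
have Re0 : 0 <= complex.Re l.
  apply: (cvgr_to_ge (cvg_Re fl)).
  by apply: filterS f0 => t; rewrite lecE => /andP[].
have Im0 : complex.Im l = 0.
  have h0 : (fun t => complex.Im (f t)) @ F --> 0.
    apply: cvg_near_cst; apply: filterS f0 => t.
    by rewrite lecE => /andP[/eqP].
  exact: (cvg_unique _ (cvg_Im fl) h0).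
by rewrite lecE Im0 eqxx Re0.
Qed.

(** Compactness of the segment gives a cluster point, and along an ultrafilter a cluster point is a
    limit. Such scalar limits take the place of weak-* compactness of the state space. *)
Lemma ultra_cvgR (T : Type) (F : set_system T) {FF : UltraFilter F} (f : T -> R) (B : R) :
  (\forall t \near F, `|f t| <= B) -> cvg (f @ F).
Proof.
move=> fB.
have [] := @segment_compact R (- B) B (f @ F).
  by apply: filterS fB => t; rewrite /= in_itv/= -ler_norml.
move=> l [_ cl]; apply/cvg_ex; exists l => A nA.
have [//|FnA] := in_ultra_setVsetC (f @^-1` A) FF.
by have [y []] := cl (~` A) A FnA nA.
Qed.

Lemma ultra_cvgC (T : Type) (F : set_system T) {FF : UltraFilter F} (f : T -> C^o) (B : R) :
  (\forall t \near F, nr (f t) <= B) -> cvg (f @ F).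
Proof.
move=> fB.
have /cvg_ex[a fa] : cvg ((fun t => complex.Re (f t)) @ F).
  apply: (@ultra_cvgR _ _ _ _ B); apply: filterS fB => t.
  exact: le_trans (Re_nr _).
have /cvg_ex[b fb] : cvg ((fun t => complex.Im (f t)) @ F).
  apply: (@ultra_cvgR _ _ _ _ B); apply: filterS fB => t.
  exact: le_trans (Im_nr _).
by apply/cvg_ex; exists (a +i* b); exact: cvg_complex.
Qed.

End RealNorm.

(** * Positive forms and inner products *)

Section PositiveForms.
Context {R : realType}.
Local Notation C := R[i].

Definition subspace_set (E : lmodType C) (A : set E) :=
  A 0 /\ forall (a : C) x y, A x -> A y -> A (a *: x + y).

Lemma subspace_setT (E : lmodType C) : subspace_set [set: E].
Proof. by []. Qed.

Section Subspaces.
Context (E : lmodType C) (A : set E) (sA : subspace_set A).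

Lemma subspaceD x y : A x -> A y -> A (x + y).
Proof. by move=> Ax Ay; have := sA.2 1 x y Ax Ay; rewrite scale1r. Qed.

Lemma subspaceZ a x : A x -> A (a *: x).
Proof. by move=> Ax; have := sA.2 a x 0 Ax sA.1; rewrite addr0. Qed.

Lemma subspaceB x y : A x -> A y -> A (x - y).
Proof. by move=> Ax Ay; rewrite addrC -scaleN1r; apply: sA.2. Qed.

End Subspaces.

(** Everything is relative to a subspace [A] because functionals such as [tau] are linear and
    positive on [M] alone. Hermitian symmetry is derived from positivity in [psd_sym]. *)
Record psd_form (E : lmodType C) (A : set E) (q : E -> E -> C) : Prop := {
  psd_linl : forall a x y z, A x -> A y -> A z ->
    q (a *: x + y) z = a * q x z + q y z ;
  psd_linr : forall a x y z, A x -> A y -> A z ->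
    q z (a *: x + y) = a^* * q z x + q z y ;
  psd_ge0 : forall x, A x -> 0 <= q x x }.

(** The quadratic of the Cauchy-Schwarz inequality for the vector x + t q(x,y) y, with m =
    |q(x,y)|^2: absorbing q(x,y) into the coefficient keeps [t] real. The value t = -1/r is the
    minimizer; when r = 0, a large negative [t] excludes m > 0. *)
Lemma discriminant_le (p m r : R) : 0 <= m -> 0 <= r ->
  (forall t : R, 0 <= p + 2 * t * m + t ^+ 2 * (m * r)) -> m <= p * r.
Proof.
move=> m0; rewrite le_eqVlt => /predU1P[<-|r0] h.
  rewrite mulr0 leNgt; apply/negP => mpos.
  have := h (- (p + 1) / (2 * m)); rewrite !mulr0 addr0.
  have -> : 2 * (- (p + 1) / (2 * m)) * m = - (p + 1) by field; rewrite gt_eqF.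
  by rewrite opprD addrA subrr add0r oppr_ge0 leNgt ltr01.
have := h (- r^-1).
have -> : p + 2 * - r^-1 * m + (- r^-1) ^+ 2 * (m * r) = p - m / r.
  by field; rewrite gt_eqF.
by rewrite subr_ge0 ler_pdivrMr.
Qed.

Section CauchySchwarz.
Context (E : lmodType C) (A : set E) (q : E -> E -> C).
Hypotheses (sA : subspace_set A) (qP : psd_form A q).

Lemma psdDl x y z : A x -> A y -> A z -> q (x + y) z = q x z + q y z.
Proof. by move=> Ax Ay Az; rewrite -[x]scale1r (psd_linl qP)// mul1r scale1r. Qed.

Lemma psdDr x y z : A x -> A y -> A z -> q z (x + y) = q z x + q z y.
Proof.
by move=> Ax Ay Az; rewrite -[x]scale1r (psd_linr qP)// rmorph1 mul1r scale1r.
Qed.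

Lemma psd0l z : A z -> q 0 z = 0.
Proof.
move=> Az; have A0 := sA.1; have := psdDl A0 A0 Az.
by rewrite addr0 => /eqP; rewrite -subr_eq0 opprD addrA subrr sub0r oppr_eq0 => /eqP.
Qed.

Lemma psd0r z : A z -> q z 0 = 0.
Proof.
move=> Az; have A0 := sA.1; have := psdDr A0 A0 Az.
by rewrite addr0 => /eqP; rewrite -subr_eq0 opprD addrA subrr sub0r oppr_eq0 => /eqP.
Qed.

Lemma psdZl a x z : A x -> A z -> q (a *: x) z = a * q x z.
Proof.
by move=> Ax Az; have := psd_linl qP a Ax sA.1 Az; rewrite addr0 psd0l ?addr0.
Qed.

Lemma psdZr a x z : A x -> A z -> q z (a *: x) = a^* * q z x.
Proof.
by move=> Ax Az; have := psd_linr qP a Ax sA.1 Az; rewrite addr0 psd0r ?addr0.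
Qed.

Lemma psd_expand a x y : A x -> A y ->
  q (x + a *: y) (x + a *: y) =
  q x x + (a^* * q x y + a * q y x) + a * a^* * q y y.
Proof.
move=> Ax Ay; have Aay := subspaceZ sA a Ay.
have Axy := subspaceD sA Ax Aay.
by rewrite psdDl// !psdDr// !psdZl// !psdZr//; ring.
Qed.

(** The value of [q] on the diagonal at x + a y is real; a = 1 matches the imaginary parts and a = i
    the real parts. *)
Lemma psd_sym x y : A x -> A y -> q y x = (q x y)^*.
Proof.
move=> Ax Ay.
have hx := ger0_Im (psd_ge0 qP Ax); have hy := ger0_Im (psd_ge0 qP Ay).
have h (a : C) : complex.Im (a^* * q x y + a * q y x) = 0.
  have := ger0_Im (psd_ge0 qP (subspaceD sA Ax (subspaceZ sA a Ay))).
  rewrite psd_expand// !ImD hx add0r.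
  rewrite (ger0_Im (x := a * a^* * q y y)) ?addr0//.
  by rewrite mulr_ge0 ?mulcJ_ge0//; exact: (psd_ge0 qP Ay).
have h1 := h 1; have h2 := h 'i%C.
move: h1 h2; case: (q x y) (q y x) => [a b] [c d] /=.
rewrite !(mul0r, mul1r, oppr0, mulr0, addr0, add0r, subr0, sub0r, oppr0, mulN1r) => h1 h2.
by congr (_ +i* _); lra.
Qed.

Lemma psd_CS x y : A x -> A y ->
  nr (q x y) ^+ 2 <= complex.Re (q x x) * complex.Re (q y y).
Proof.
move=> Ax Ay.
have [hx hx'] : 0 <= complex.Re (q x x) /\ complex.Im (q x x) = 0.
  by have := psd_ge0 qP Ax; rewrite lecE => /andP[/eqP].
have [hy hy'] : 0 <= complex.Re (q y y) /\ complex.Im (q y y) = 0.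
  by have := psd_ge0 qP Ay; rewrite lecE => /andP[/eqP].
have nE : nr (q x y) ^+ 2 = complex.Re (q x y) ^+ 2 + complex.Im (q x y) ^+ 2.
  by apply: (@complexI R); rewrite add_Re2_Im2 nrE rmorphXn.
apply: discriminant_le => //; first by rewrite exprn_ge0// nr_ge0.
move=> t; pose a := t%:C * q x y.
have := psd_ge0 qP (subspaceD sA Ax (subspaceZ sA a Ay)).
rewrite psd_expand// lecE => /andP[_].
rewrite (psd_sym Ax Ay) nE /a.
move: hx' hy'; case: (q x y) (q x x) (q y y) => [u v] [p p'] [r r'] /= hp hr; rewrite hr.
congr (0 <= _); ring.
Qed.

End CauchySchwarz.

End PositiveForms.

Section HilbertBasics.
Context {R : realType} {H : hilbertType R}.
Local Notation C := R[i].
Implicit Types x y z : H.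

Lemma innerDl x y z : inner (x + y) z = inner x z + inner y z.
Proof. exact: linearDl. Qed.

Lemma innerDr x y z : inner z (x + y) = inner z x + inner z y.
Proof. exact: linearDr. Qed.

Lemma innerZl (a : C) x z : inner (a *: x) z = a * inner x z.
Proof. exact: linearZl_LR. Qed.

Lemma innerZr (a : C) x z : inner z (a *: x) = a^* * inner z x.
Proof. exact: linearZr_LR. Qed.

Lemma innerBl x y z : inner (x - y) z = inner x z - inner y z.
Proof. exact: linearBl. Qed.

Lemma innerBr x y z : inner z (x - y) = inner z x - inner z y.
Proof. exact: linearBr. Qed.

Lemma inner0l x : inner 0 x = 0. Proof. exact: linear0l. Qed.

Lemma inner0r x : inner x 0 = 0. Proof. exact: linear0r. Qed.

Lemma inner_nr x : inner x x = (nr x ^+ 2)%:C.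
Proof. by rewrite inner_norm nrE rmorphXn. Qed.

Lemma inner_psd : psd_form [set: H] (@inner R H).
Proof.
split=> *; first by rewrite innerDl innerZl.
- by rewrite innerDr innerZr.
- by rewrite inner_nr ler0c exprn_ge0// nr_ge0.
Qed.

Lemma inner_sym x y : inner y x = (inner x y)^*.
Proof. by apply: (psd_sym (subspace_setT H) inner_psd). Qed.

Lemma inner_CS x y : nr (inner x y) <= nr x * nr y.
Proof.
rewrite -(@ler_pXn2r _ 2) ?nnegrE ?mulr_ge0 ?nr_ge0// exprMn.
have := psd_CS (subspace_setT H) inner_psd (x := x) (y := y) I I.
by rewrite !inner_nr.
Qed.

Lemma nrD_sqr x y :
  nr (x + y) ^+ 2 = nr x ^+ 2 + nr y ^+ 2 + 2 * complex.Re (inner x y).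
Proof.
apply: (@complexI R); rewrite -inner_nr innerDl !innerDr !inner_nr (inner_sym x y).
rewrite !rmorphD/= [(2 * _)%:C]rmorphM/= (_ : 2%:C = 2%:R)// ?rmorph_nat// -addcJ.
by ring.
Qed.

Lemma nrB_sqr x y :
  nr (x - y) ^+ 2 = nr x ^+ 2 + nr y ^+ 2 - 2 * complex.Re (inner x y).
Proof. by rewrite nrD_sqr nrN -scaleN1r innerZr rmorphN1 mulN1r raddfN/= mulrN. Qed.

Lemma parallelogram x y :
  nr (x + y) ^+ 2 + nr (x - y) ^+ 2 = 2 * nr x ^+ 2 + 2 * nr y ^+ 2.
Proof. by rewrite nrD_sqr nrB_sqr; ring. Qed.

Lemma inner_ext x y : (forall z, inner z x = inner z y) -> x = y.
Proof.
move=> h; apply/eqP; rewrite -subr_eq0 -(@nr_eq0 R) -sqrf_eq0.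
by rewrite -(inj_eq (@complexI R)) -inner_nr innerBr h subrr.
Qed.

Lemma inner_extl x y : (forall z, inner x z = inner y z) -> x = y.
Proof. by move=> h; apply: inner_ext => z; rewrite inner_sym h -inner_sym. Qed.

Lemma cvg_inner (T : Type) (F : set_system T) {FF : Filter F} (f g : T -> H) x y :
  f @ F --> x -> g @ F --> y ->
  (fun t => inner (f t) (g t) : C^o) @ F --> (inner x y : C^o).
Proof.
move=> fx gy.
have /cvg_nrP fx0 := fx; have /cvg_nrP gy0 := gy.
apply: (@nr_squeeze _ _ _ _ _ _ _
   (fun t => nr (f t) * nr (g t - y) + nr (f t - x) * nr y)).
  apply: nearW => t.
  have -> : inner (f t) (g t) - inner x y =
      inner (f t) (g t - y) + inner (f t - x) y.
    by rewrite innerBr innerBl addrA subrK.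
  by rewrite (le_trans (nrD _ _))// lerD// inner_CS.
rewrite -[X in _ --> X](_ : nr x * 0 + 0 * nr y = 0); last first.
  by rewrite mulr0 mul0r addr0.
by apply: cvgD; [apply: cvgM => //; exact: cvg_nr|exact: cvgMr_tmp].
Qed.

Lemma cvg_innerl (T : Type) (F : set_system T) {FF : Filter F} (f : T -> H) x y :
  f @ F --> x -> (fun t => inner (f t) y : C^o) @ F --> (inner x y : C^o).
Proof. by move=> fx; apply: cvg_inner => //; exact: cvg_cst. Qed.

Lemma cvg_innerr (T : Type) (F : set_system T) {FF : Filter F} (f : T -> H) x y :
  f @ F --> x -> (fun t => inner y (f t) : C^o) @ F --> (inner y x : C^o).
Proof. by move=> fx; apply: cvg_inner => //; exact: cvg_cst. Qed.

Lemma cauchy_nr_cvg (u : nat -> H) :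
  (forall e : R, 0 < e -> exists n0, forall k l, (n0 <= k)%N -> (n0 <= l)%N ->
    nr (u k - u l) < e) ->
  exists x, u @ \oo --> x.
Proof.
move=> h; apply/cvg_ex; apply/cauchy_cvgP/cauchy_ballP => e e0.
have eE : e = (complex.Re e)%:C by rewrite RRe_real// realE ltW.
have er0 : 0 < complex.Re e by rewrite -ltcR -eE.
have [n0 hn0] := h _ er0.
pose A : set H := [set u k | k in [set k | (n0 <= k)%N]].
have FA : (u @ \oo) A by exists n0 => // k /= n0k; exists k.
exists (A, A) => //= -[_ _] /= [[k n0k <-] [l n0l <-]].
by rewrite -ball_normE /ball_/= eE nrE ltcR hn0.
Qed.

Lemma cvg_cauchy_nr (u : nat -> H) x : u @ \oo --> x ->
  forall e : R, 0 < e -> exists n0, forall k l, (n0 <= k)%N -> (n0 <= l)%N ->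
    nr (u k - u l) < e.
Proof.
move=> /cvg_nrP/cvgrPdist_lt h e e0.
have /h[n0 _ hn0] : 0 < e / 2 by rewrite divr_gt0.
exists n0 => k l /hn0 + /hn0; rewrite /= !sub0r !normrN !ger0_norm ?nr_ge0// => hk hl.
rewrite -(subrKA x) (le_lt_trans (nrD _ _))// (splitr e) ltrD//.
by rewrite nr_dist.
Qed.

End HilbertBasics.

(** * The Riesz theorem, bounded operators and adjoints *)

(** A first-variation argument; dividing by [b + 1] rather than [b] covers b = 0. *)
Lemma vertex_eq0 (R : realFieldType) (a b : R) : 0 <= b ->
  (forall t : R, 0 <= 2 * t * a + t ^+ 2 * b) -> a = 0.
Proof.
move=> b0 /(_ (- a / (b + 1))).
have b1 : 0 < b + 1 by rewrite ltr_wpDl.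
have -> : 2 * (- a / (b + 1)) * a + (- a / (b + 1)) ^+ 2 * b =
    - (a ^+ 2 * ((b + 2) / (b + 1) ^+ 2)) by field; rewrite gt_eqF.
rewrite oppr_ge0 => h; apply/eqP; rewrite -sqrf_eq0 eq_le sqr_ge0 andbT.
by rewrite -(pmulr_lle0 _ (x := (b + 2) / (b + 1) ^+ 2)) ?divr_gt0 ?exprn_gt0// ltr_wpDl.
Qed.

Section Riesz.
Context {R : realType} {H : hilbertType R}.
Local Notation C := R[i].

(** The map [u] lets one statement serve both projections ([u = id]) and functionals on an algebra
    seen through [a |-> pi a xi], without quotients or completions. A minimizing sequence of the
    energy [J] has Cauchy images, and the first variation identifies their limit. The sequence is
    kept in the conclusion because later [v] is used as a limit of algebra elements applied to a
    vector. *)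
Lemma riesz (E : lmodType C) (A : set E) (u : E -> H) (F : E -> C) (B : R) :
  subspace_set A ->
  (forall (a : C) x y, A x -> A y -> u (a *: x + y) = a *: u x + u y) ->
  (forall (a : C) x y, A x -> A y -> F (a *: x + y) = a * F x + F y) ->
  (forall x, A x -> nr (F x) <= B * nr (u x)) ->
  exists v (s : nat -> E), [/\ forall k, A (s k),
    (fun k => u (s k)) @ \oo --> v & forall x, A x -> F x = inner (u x) v].
Proof.
move=> sA ul Fl FB.
have uD x y : A x -> A y -> u (x + y) = u x + u y.
  by move=> Ax Ay; rewrite -[x]scale1r ul// !scale1r.
have FD x y : A x -> A y -> F (x + y) = F x + F y.
  by move=> Ax Ay; rewrite -[x]scale1r Fl// scale1r mul1r.
have A0 := sA.1.
have u0 : u 0 = 0 by apply: (addIr (u 0)); rewrite -uD// !add0r.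
have F0 : F 0 = 0 by apply: (addIr (F 0)); rewrite -FD// !add0r.
have uZ a x : A x -> u (a *: x) = a *: u x.
  by move=> Ax; have := ul a x 0 Ax A0; rewrite u0 !addr0.
have FZ a x : A x -> F (a *: x) = a * F x.
  by move=> Ax; have := Fl a x 0 Ax A0; rewrite F0 !addr0.
pose J x := nr (u x) ^+ 2 - 2 * complex.Re (F x).
have JB x : A x -> - B ^+ 2 <= J x.
  move=> Ax; have h1 := FB _ Ax; have h2 := Re_nr (F x).
  have h3 := le_trans (ler_norm _) (le_trans h2 h1).
  by rewrite /J; have := sqr_ge0 (nr (u x) - B); nra.
have iJ : has_inf [set J x | x in A].
  by split; [exists (J 0), 0|exists (- B ^+ 2) => _ [x Ax <-]; exact: JB].
set d := inf [set J x | x in A].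
have dJ x : A x -> d <= J x.
  by move=> Ax; apply: ge_inf; [case: iJ|exists x].
have /choice[s sP] : forall k : nat, exists x, A x /\ J x < d + k.+1%:R^-1.
  move=> k; have [|_ [x Ax <-] Jx] := @inf_adherent _ _ (k.+1%:R^-1 : R) _ iJ.
    by rewrite invr_gt0.
  by exists x.
have As k := (sP k).1.
(* The midpoint of [x] and [y] has energy at least [d], so by the parallelogram law near-minimizers
   have close images. *)
have mid x y : A x -> A y -> nr (u x - u y) ^+ 2 <= 2 * (J x + J y - 2 * d).
  move=> Ax Ay; have Axy := subspaceD sA Ax Ay.
  have := dJ _ (subspaceZ sA (2^-1)%:C Axy).
  rewrite /J uZ// FZ// uD// FD// nrZ nrR ger0_norm ?invr_ge0// ReZ ReD.
  by have := parallelogram (u x) (u y); nra.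
have [v sv] : exists v : H, (fun k => u (s k)) @ \oo --> v.
  apply: cauchy_nr_cvg => e e0.
  have [n0 hn0] : exists n0 : nat, 4 * n0.+1%:R^-1 < e ^+ 2.
    have e4 : 0 < e ^+ 2 / 4 by rewrite divr_gt0// exprn_gt0.
    have [n _ hn] := near_infty_natSinv_lt (PosNum e4); exists n.
    by rewrite mulrC -ltr_pdivlMr//; exact: hn (leqnn n).
  exists n0 => k l kn ln; rewrite -(@ltr_pXn2r _ 2) ?nnegrE ?nr_ge0 ?(ltW e0)//.
  apply: le_lt_trans hn0; apply: (le_trans (mid _ _ (As k) (As l))).
  have hk : J (s k) <= d + n0.+1%:R^-1.
    by apply: (le_trans (ltW (sP k).2)); rewrite lerD2l lef_pV2 ?posrE// ler_nat.
  have hl : J (s l) <= d + n0.+1%:R^-1.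
    by apply: (le_trans (ltW (sP l).2)); rewrite lerD2l lef_pV2 ?posrE// ler_nat.
  clear -hk hl; move: (J _) (J _) (n0.+1%:R^-1) d hk hl => a b c d hk hl; lra.
have Jlim : (fun k => J (s k)) @ \oo --> d.
  apply/cvgrPdist_lt => e e0; near=> k.
  rewrite ler0_norm ?subr_le0 ?dJ// opprB ltrBlDl.
  apply: (lt_trans (sP k).2); rewrite ltrD2l; near: k.
  exact: (near_infty_natSinv_lt (PosNum e0)).
have ReE x : A x -> complex.Re (F x) = complex.Re (inner (u x) v).
  move=> Ax; apply/esym/eqP; rewrite -subr_eq0; apply/eqP.
  apply: (@vertex_eq0 _ _ (nr (u x) ^+ 2)) => [|t]; first by rewrite sqr_ge0.
  (* This is [J (s k + t%:C *: x) - d] expanded, hence nonnegative. *)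
  pose g k := J (s k) - d + 2 * t * (complex.Re (inner (u x) (u (s k))) - complex.Re (F x))
    + t ^+ 2 * nr (u x) ^+ 2.
  have gl : g @ \oo --> d - d + 2 * t * (complex.Re (inner (u x) v) - complex.Re (F x))
      + t ^+ 2 * nr (u x) ^+ 2.
    apply: cvgD; last exact: cvg_cst.
    apply: cvgD; first by apply: cvgB => //; exact: cvg_cst.
    apply: cvgMl_tmp; apply: cvgB; last exact: cvg_cst.
    by apply: (@cvg_Re _ _ _ _ (fun k => inner (u x) (u (s k)))); exact: cvg_innerr.
  rewrite subrr add0r in gl; apply: (cvgr_to_ge gl).
  apply: nearW => k; rewrite /g.
  have Atx := subspaceZ sA t%:C Ax.
  have := dJ _ (subspaceD sA (As k) Atx).
  rewrite /J uD// FD// uZ// FZ// nrD_sqr nrZ nrR ReD ReZ.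
  rewrite innerZr (inner_sym (u x)).
  have -> : complex.Re (t%:C^* * (inner (u x) (u (s k)))^*) =
      t * complex.Re (inner (u x) (u (s k))).
    by case: (inner _ _) => a b /=; rewrite oppr0 mul0r subr0.
  by rewrite exprMn real_normK ?num_real//; lra.
exists v, s; split => // x Ax.
(* Equality of real parts at i x is equality of imaginary parts at x. *)
have h1 := ReE _ Ax; have := ReE _ (subspaceZ sA 'i%C Ax).
rewrite FZ// uZ// innerZl; move: h1.
case: (F x) (inner _ _) => [a b] [a' b'] /= -> .
rewrite !mul0r !mul1r !sub0r => /oppr_inj -> //.
Unshelve. all: by end_near. Qed.

End Riesz.

Section BoundedMaps.
Context {R : realType}.
Local Notation C := R[i].

Definition bounded_linear (H K : hilbertType R) (f : H -> K) : Prop :=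
  linear f /\ exists B : R, forall x, nr (f x) <= B * nr x.

Section Theory.
Context (H K : hilbertType R) (f : H -> K) (fP : bounded_linear f).

Lemma blD x y : f (x + y) = f x + f y.
Proof. by have := fP.1 1 x y; rewrite !scale1r. Qed.

Lemma bl0 : f 0 = 0.
Proof. by apply: (addIr (f 0)); rewrite -blD !add0r. Qed.

Lemma blZ a x : f (a *: x) = a *: f x.
Proof. by have := fP.1 a x 0; rewrite bl0 !addr0. Qed.

Lemma blB x y : f (x - y) = f x - f y.
Proof. by rewrite blD -scaleN1r blZ scaleN1r. Qed.

Lemma bl_sum (I : Type) (r : seq I) (g : I -> H) :
  f (\sum_(i <- r) g i) = \sum_(i <- r) f (g i).
Proof. by apply: big_morph; [exact: blD|exact: bl0]. Qed.

Lemma bl_bound : exists2 B : R, 0 <= B & forall x, nr (f x) <= B * nr x.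
Proof.
have [B hB] := fP.2; exists `|B| => // x.
by rewrite (le_trans (hB x))// ler_wpM2r ?nr_ge0// ler_norm.
Qed.

Lemma bl_cvg (T : Type) (F : set_system T) {FF : Filter F} (g : T -> H) x :
  g @ F --> x -> (fun t => f (g t)) @ F --> f x.
Proof.
move=> /cvg_nrP gx; have [B B0 hB] := bl_bound.
apply: (@nr_squeeze _ _ _ _ _ _ _ (fun t => B * nr (g t - x))).
  by apply: nearW => t; rewrite -blB.
by rewrite -(mulr0 B); exact: cvgMl_tmp.
Qed.

End Theory.

Lemma bl_comp (H K L : hilbertType R) (f : H -> K) (g : K -> L) :
  bounded_linear f -> bounded_linear g -> bounded_linear (g \o f).
Proof.
move=> fP gP; split=> [a x y|]; first by rewrite /= fP.1 gP.1.
have [B B0 hB] := bl_bound fP; have [D D0 hD] := bl_bound gP.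
exists (D * B) => x /=; rewrite (le_trans (hD _))// -mulrA ler_wpM2l//.
Qed.

Lemma sesqui_representation (H K : hilbertType R) (b : H -> K -> C) (B : R) :
  0 <= B ->
  (forall (a : C) x x' y, b (a *: x + x') y = a * b x y + b x' y) ->
  (forall (a : C) x y y', b x (a *: y + y') = a^* * b x y + b x y') ->
  (forall x y, nr (b x y) <= B * nr x * nr y) ->
  exists2 S : K -> H, bounded_linear S & forall x y, b x y = inner x (S y).
Proof.
move=> B0 bl br bB.
have /choice[S SE] : forall y, exists v, forall x, b x y = inner x v.
  move=> y; have [||||v [s [_ _ h]]] := @riesz R H H setT id (b^~ y) (B * nr y).
  - exact: subspace_setT.
  - by [].
  - by move=> a x x' _ _; exact: bl.
  - by move=> x _; rewrite mulrAC.
  - by exists v => x; exact: h.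
exists S => //; split=> [a x y|].
  by apply: inner_ext => z; rewrite -SE br innerDr innerZr -!SE.
exists B => y; have := bB (S y) y; rewrite SE inner_nr nrR ger0_norm ?sqr_ge0//.
rewrite expr2 -mulrA [in X in _ <= X]mulrCA.
have [->|Sy0] := eqVneq (nr (S y)) 0; first by rewrite mulr_ge0 ?nr_ge0.
by rewrite ler_pM2l// lt_neqAle eq_sym Sy0 nr_ge0.
Qed.

End BoundedMaps.

Section Operators.
Context {R : realType} {H : hilbertType R}.
Local Notation C := R[i].
Implicit Types S T P : bop H.

Lemma bopP T : bounded_linear T.
Proof.
have /asboolP[lf cf] := bop_funP T; split => //.
pose g : {linear H -> H} := HB.pack_for {linear H -> H} (bop_fun T)
  (GRing.isLinear.Build C H H *:%R (bop_fun T) lf).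
have /linear_bounded_continuous/linear_boundedP : continuous g by [].
move=> /pinfty_ex_gt0[B B0 hB].
exists (complex.Re B) => x; have BE : B = (complex.Re B)%:C.
  by rewrite RRe_real// realE ltW.
by have := hB x; rewrite /= !nrE BE -rmorphM lecR.
Qed.

Lemma bounded_linear_op (f : H -> H) : bounded_linear f -> f \in @bounded_op R H.
Proof.
by move=> fP; apply/asboolP; split=> [|x]; [exact: fP.1|exact: (bl_cvg fP)].
Qed.

Lemma bop_ext S T : (forall x, S x = T x) -> S = T.
Proof. by move=> h; apply: val_inj; apply/funext. Qed.

Lemma bopDE S T x : (S + T) x = S x + T x. Proof. by []. Qed.
Lemma bopZE (a : C) S x : (a *: S) x = a *: S x. Proof. by []. Qed.
Lemma bopME S T x : (S * T) x = S (T x). Proof. by []. Qed.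
Lemma bopBE S T x : (S - T) x = S x - T x. Proof. by []. Qed.
Lemma bop1E x : (1 : bop H) x = x. Proof. by []. Qed.
Lemma bop0E x : (0 : bop H) x = 0. Proof. by []. Qed.

Lemma bopD T x y : T (x + y) = T x + T y. Proof. exact: (blD (bopP T)). Qed.
Lemma bopB T x y : T (x - y) = T x - T y. Proof. exact: (blB (bopP T)). Qed.
Lemma bopZ T a x : T (a *: x) = a *: T x. Proof. exact: (blZ (bopP T)). Qed.
Lemma bop0 T : T 0 = 0. Proof. exact: (bl0 (bopP T)). Qed.

Lemma bopZMl (a : C) S T : (a *: S) * T = a *: (S * T).
Proof. by apply: bop_ext. Qed.

Lemma bopZMr (a : C) S T : S * (a *: T) = a *: (S * T).
Proof. by apply: bop_ext => x; rewrite bopME !bopZE bopZ. Qed.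

Lemma bop_form (b : H -> H -> C) (B : R) : 0 <= B ->
  (forall (a : C) x x' y, b (a *: x + x') y = a * b x y + b x' y) ->
  (forall (a : C) x y y', b x (a *: y + y') = a^* * b x y + b x y') ->
  (forall x y, nr (b x y) <= B * nr x * nr y) ->
  exists S, forall x y, inner (S x) y = b x y.
Proof.
move=> B0 bl br bB.
have [||||S SP SE] := @sesqui_representation R H H (fun y x => (b x y)^*) B.
- by [].
- by move=> a y y' x; rewrite br rmorphD rmorphM /= conjCK.
- by move=> a y x x'; rewrite bl rmorphD rmorphM.
- by move=> y x; rewrite nr_conj mulrAC.
exists (Bop (bounded_linear_op SP)) => x y /=.
by rewrite inner_sym -SE conjCK.
Qed.

Lemma adjE T x y : inner (T x) y = inner x (adj T y).
Proof.
have [S hS] : [set S : bop H | forall x y, inner (T x) y = inner x (S y)] !=set0.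
  have [B B0 TB] := bl_bound (bopP T).
  have [||||S SP SE] := @sesqui_representation R H H (fun x y => inner (T x) y) B.
  - by [].
  - by move=> a u v z; rewrite bopD bopZ innerDl innerZl.
  - by move=> a u v z; rewrite innerDr innerZr.
  - by move=> u v; rewrite (le_trans (inner_CS _ _))// ler_wpM2r// nr_ge0.
  by exists (Bop (bounded_linear_op SP)).
by rewrite /adj; case: xgetP => [S' _ ->//|/(_ S)].
Qed.

Lemma adjE' T x y : inner (adj T x) y = inner x (T y).
Proof. by rewrite inner_sym -adjE -inner_sym. Qed.

Lemma adj_uniq T S : (forall x y, inner (T x) y = inner x (S y)) -> adj T = S.
Proof.
by move=> h; apply: bop_ext => y; apply: inner_ext => z; rewrite -adjE h.
Qed.

Lemma adjK T : adj (adj T) = T.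
Proof. by apply: adj_uniq => x y; rewrite adjE'. Qed.

Lemma adjM S T : adj (S * T) = adj T * adj S.
Proof. by apply: adj_uniq => x y; rewrite !bopME !adjE. Qed.

Lemma adjD S T : adj (S + T) = adj S + adj T.
Proof. by apply: adj_uniq => x y; rewrite !bopDE innerDl innerDr !adjE. Qed.

Lemma adjZ (a : C) T : adj (a *: T) = a^* *: adj T.
Proof.
by apply: adj_uniq => x y; rewrite !bopZE innerZl innerZr conjCK adjE.
Qed.

Lemma adjB S T : adj (S - T) = adj S - adj T.
Proof. by apply: adj_uniq => x y; rewrite !bopBE innerBl innerBr !adjE. Qed.

Lemma adj0 : adj 0 = 0 :> bop H.
Proof. by apply: adj_uniq => x y; rewrite !bop0E inner0l inner0r. Qed.

Lemma adj1 : adj 1 = 1 :> bop H.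
Proof. by apply: adj_uniq. Qed.

Lemma nr_adj T (B : R) : 0 <= B -> (forall x, nr (T x) <= B * nr x) ->
  forall x, nr (adj T x) <= B * nr x.
Proof.
move=> B0 hB x; have [->|n0] := eqVneq (nr (adj T x)) 0.
  by rewrite mulr_ge0 ?nr_ge0.
have npos : 0 < nr (adj T x) by rewrite lt_neqAle eq_sym n0 nr_ge0.
rewrite -(ler_pM2l npos) -expr2.
have -> : nr (adj T x) ^+ 2 = nr (inner (T (adj T x)) x).
  by rewrite adjE inner_nr nrR ger0_norm// sqr_ge0.
by rewrite (le_trans (inner_CS _ _))// mulrCA mulrA ler_wpM2r ?nr_ge0.
Qed.

(** The target is the closure of [D], described by sequences, so that [D] may be an orbit such as
    [M v], which is rarely closed. *)
Lemma projection (D : set H) : subspace_set D -> exists P : bop H,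
  (forall x, exists2 s : nat -> H, forall k, D (s k) & s @ \oo --> P x) /\
  (forall x d, D d -> inner d (P x) = inner d x).
Proof.
move=> sD.
have /choice[P PP] : forall x, exists v,
    (exists2 s : nat -> H, forall k, D (s k) & s @ \oo --> v) /\
    (forall d, D d -> inner d v = inner d x).
  move=> x; have [||||v [s [Ds sv h]]] := @riesz R H H D id (inner^~ x) (nr x).
  - exact: sD.
  - by [].
  - by move=> a y y' _ _; rewrite innerDl innerZl.
  - by move=> y _; rewrite mulrC inner_CS.
  - by exists v; split; [exists s|move=> d Dd; rewrite -h].
(* The defining identity passes from [D] to its closure, which contains [P y]; linearity and
   contractivity of [P] both follow from this. *)
have inD x y : inner (P y) (P x) = inner (P y) x.
  have [[s Ds sy] _] := PP y.
  apply: (lim_uniqC (cvg_innerl (y := P x) sy)).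
  have -> : (fun k => inner (s k) (P x)) = (fun k => inner (s k) x).
    by apply/funext => k; rewrite (PP x).2.
  exact: cvg_innerl.
have Pbl : bounded_linear P.
  split=> [a x y|].
    apply/eqP; rewrite -subr_eq0 -(@nr_eq0 R) -sqrf_eq0.
    rewrite -(inj_eq (@complexI R)) -inner_nr.
    set w := _ - _; have wP z : inner w (P z) = inner w z.
      by rewrite /w !(innerBl, innerDl, innerZl) !inD.
    rewrite {2}/w innerBr innerDr innerZr !wP innerDr innerZr.
    by rewrite subrr.
  exists 1 => x; rewrite mul1r.
  have [->|n0] := eqVneq (nr (P x)) 0; first by rewrite nr_ge0.
  have npos : 0 < nr (P x) by rewrite lt_neqAle eq_sym n0 nr_ge0.
  rewrite -(ler_pM2l npos) -expr2.
  have -> : nr (P x) ^+ 2 = nr (inner (P x) x).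
    by rewrite -inD inner_nr nrR ger0_norm// sqr_ge0.
  exact: inner_CS.
by exists (Bop (bounded_linear_op Pbl)); split=> x; [exact: (PP x).1|exact: (PP x).2].
Qed.

End Operators.

(** * Projections, square roots and states *)

Section ProjectionCommutes.
Context {R : realType} {H : hilbertType R}.
Local Notation C := R[i].

Definition projects_on (D : set H) (P : bop H) :=
  (forall x, exists2 s : nat -> H, forall k, D (s k) & s @ \oo --> P x) /\
  (forall x d, D d -> inner d (P x) = inner d x).

Lemma projects_on_uniq (D : set H) (P : bop H) x v :
  projects_on D P -> (exists2 s : nat -> H, forall k, D (s k) & s @ \oo --> v) ->
  (forall d, D d -> inner d v = inner d x) -> P x = v.
Proof.
move=> [P1 P2] [s Ds sv] vx; have [r Dr rPx] := P1 x.
apply/eqP; rewrite -subr_eq0 -(@nr_eq0 R) -sqrf_eq0.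
rewrite -(inj_eq (@complexI R)) -inner_nr rmorph0; apply/eqP.
have h : (fun k => r k - s k) @ \oo --> P x - v by exact: cvgB.
apply: (lim_uniqC (cvg_innerl (y := P x - v) h)).
apply: cvg_near_cst; apply: nearW => k.
by rewrite innerBr !innerBl !P2// !vx// subrr.
Qed.

Lemma projects_on_id (D : set H) P x : projects_on D P -> D x -> P x = x.
Proof.
move=> DP Dx; apply: projects_on_uniq DP _ _ => //.
by exists (fun=> x) => //; exact: cvg_cst.
Qed.

(** Invariance under [S] puts S P x in the closure of [D]; invariance under the adjoint makes S x -
    S P x orthogonal to [D]. *)
Lemma projects_on_comm (D : set H) P (S : bop H) : projects_on D P ->
  (forall d, D d -> D (S d)) -> (forall d, D d -> D (adj S d)) ->
  P * S = S * P.
Proof.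
move=> DP DS DS'; apply: bop_ext => x; rewrite !bopME.
apply: (projects_on_uniq DP).
  have [s Ds sx] := DP.1 x; exists (fun k => S (s k)); first by move=> k; exact: DS.
  by apply: (bl_cvg (bopP S)).
by move=> d Dd; rewrite -[S]adjK -!adjE DP.2//; exact: DS'.
Qed.

End ProjectionCommutes.

Section SquareRoot.
Context {R : realType} {H : hilbertType R}.
Local Notation C := R[i].
Implicit Types S T P : bop H.

Definition psd_op P := forall x, 0 <= inner (P x) x.

Lemma psd_op_form P : psd_op P -> psd_form [set: H] (fun x y => inner (P x) y).
Proof.
move=> P0; split=> // [a x y z _ _ _|a x y z _ _ _].
  by rewrite bopD bopZ innerDl innerZl.
by rewrite innerDr innerZr.
Qed.

(** In [R[i]], [0 <= z] says in particular that [z] is real, so self-adjointness comes from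
    polarization. *)
Lemma psd_op_adj P : psd_op P -> adj P = P.
Proof.
move=> P0; apply: adj_uniq => x y.
by rewrite [RHS]inner_sym -(psd_sym (subspace_setT H) (psd_op_form P0)).
Qed.

Lemma cauchy_op_cvg (Y : nat -> bop H) (q : R) : 0 <= q -> q < 1 ->
  (forall k x, nr ((Y k.+1 - Y k) x) <= q ^+ k * nr x) ->
  forall x, exists y : H, (fun k => Y k x) @ \oo --> y.
Proof.
move=> q0 q1 hY x.
have hd k n : nr (Y (k + n)%N x - Y k x) <= q ^+ k * (1 - q ^+ n) / (1 - q) * nr x.
  elim: n => [|n IH]; first by rewrite addn0 subrr nr0 expr0 subrr mulr0 mul0r mul0r.
  rewrite addnS -(subrKA (Y (k + n)%N x)) (le_trans (nrD _ _))//.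
  rewrite (le_trans (lerD (hY (k + n)%N x) IH))// -mulrDl ler_wpM2r ?nr_ge0//.
  rewrite le_eqVlt; apply/orP; left; apply/eqP.
  by rewrite exprD exprS; field; rewrite subr_eq0 gt_eqF.
have hd' k l : (k <= l)%N -> nr (Y l x - Y k x) <= q ^+ k * ((1 - q)^-1 * nr x).
  move=> /subnKC <-; rewrite (le_trans (hd _ _))// mulrA ler_wpM2r ?nr_ge0//.
  rewrite ler_wpM2r ?invr_ge0 ?subr_ge0 ?(ltW q1)// ler_piMr ?exprn_ge0//.
  by rewrite gerBl exprn_ge0.
apply: cauchy_nr_cvg => e e0.
have : (fun k => q ^+ k * ((1 - q)^-1 * nr x)) @ \oo --> 0 * ((1 - q)^-1 * nr x).
  by apply: cvgMr_tmp; apply: cvg_expr; rewrite ger0_norm.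
rewrite mul0r => /cvgrPdist_lt/(_ (e / 2) (divr_gt0 e0 (ltr0n _ 2)))[n0 _ hn0].
exists n0 => k l kn ln; rewrite -(subrKA (Y n0 x)) (le_lt_trans (nrD _ _))//.
have hb : q ^+ n0 * ((1 - q)^-1 * nr x) < e / 2.
  have := hn0 n0 (leqnn n0); rewrite /= sub0r normrN; exact: le_lt_trans (ler_norm _).
rewrite [ltRHS]splitr ltrD// ?(le_lt_trans (hd' _ _ kn))// nr_dist.
by rewrite (le_lt_trans (hd' _ _ ln)).
Qed.

(* The solution is the fixed point of the contraction [Y |-> (t + Y^2) / 2],
   so that [1 - Y] is the square root of [1 - t]. *)
Lemma sqrt_one_minus (t : bop H) (q : R) : 0 <= q -> q < 1 -> adj t = t ->
  (forall x, nr (t x) <= q * nr x) ->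
  exists S, 1 - t = adj S * S.
Proof.
move=> q0 q1 tsa tq.
pose h : C := (2^-1)%:C.
have [Y [Y0 YS]] : exists Y : nat -> bop H,
    Y 0 = 0 /\ forall k, Y k.+1 = h *: (t + Y k * Y k).
  by exists (fix Y k := if k is k'.+1 then h *: (t + Y k' * Y k') else 0).
have hnr (x : H) : nr (h *: x) = 2^-1 * nr x by rewrite nrZ nrR ger0_norm ?invr_ge0.
have hJ : h^* = h by exact: conjR.
have Yq k x : nr (Y k x) <= q * nr x.
  elim: k x => [|k IH] x; first by rewrite Y0 bop0E nr0 mulr_ge0 ?nr_ge0.
  rewrite YS bopZE hnr bopDE bopME.
  have h1 : nr (Y k (Y k x)) <= q * nr x.
    rewrite (le_trans (IH _))// (le_trans (ler_wpM2l q0 (IH _)))//.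
    by rewrite ler_wpM2l// ler_piMl ?nr_ge0// ltW.
  have := nrD (t x) (Y k (Y k x)); have := tq x; lra.
have Ysa k : adj (Y k) = Y k.
  elim: k => [|k IH]; first by rewrite Y0 adj0.
  by rewrite YS adjZ hJ adjD tsa adjM IH.
have dY k x : nr ((Y k.+1 - Y k) x) <= q ^+ k * nr x.
  elim: k x => [|k IH] x.
    rewrite expr0 mul1r bopBE YS Y0 bopZE bopDE bopME !bop0E addr0 subr0 hnr.
    have := tq x; have := nr_ge0 x; nra.
  have -> : (Y k.+2 - Y k.+1) x =
      h *: (Y k.+1 ((Y k.+1 - Y k) x) + (Y k.+1 - Y k) (Y k x)).
    have e1 : Y k.+2 x = h *: (t x + Y k.+1 (Y k.+1 x)) by rewrite YS.
    have e2 : Y k.+1 x = h *: (t x + Y k (Y k x)) by rewrite YS.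
    rewrite bopBE e1 [X in _ - X]e2 -scalerBr; congr (_ *: _).
    by rewrite !bopBE bopB opprD addrACA subrr add0r subrKA.
  rewrite hnr.
  have h1 : nr (Y k.+1 ((Y k.+1 - Y k) x)) <= q ^+ k.+1 * nr x.
    by rewrite (le_trans (Yq _ _))// exprS -mulrA ler_wpM2l.
  have h2 : nr ((Y k.+1 - Y k) (Y k x)) <= q ^+ k.+1 * nr x.
    by rewrite (le_trans (IH _))// exprSr -mulrA ler_wpM2l// exprn_ge0.
  have := nrD (Y k.+1 ((Y k.+1 - Y k) x)) ((Y k.+1 - Y k) (Y k x)); lra.
have /choice[Z ZY] := cauchy_op_cvg q0 q1 dY.
have Zbl : bounded_linear Z.
  split=> [a x y|].
    apply: (lim_uniq (ZY _)).
    under eq_fun do rewrite bopD bopZ.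
    by apply: cvgD => //; exact: cvgZl_tmp.
  exists q => x; apply: (cvgr_to_le (cvg_nr (ZY x))).
  by apply: nearW => k; exact: Yq.
pose W := Bop (bounded_linear_op Zbl).
have WY x : (fun k => Y k x) @ \oo --> W x by exact: ZY.
have WW x : (fun k => Y k (Y k x)) @ \oo --> W (W x).
  have -> : (fun k => Y k (Y k x)) = (fun k => Y k (Y k x - W x) + Y k (W x)).
    by apply/funext => k; rewrite bopB subrK.
  rewrite -[W (W x)]add0r; apply: cvgD => //.
  apply: (@nr_squeeze _ _ _ _ _ _ _ (fun k => q * nr (Y k x - W x))).
    by apply: nearW => k; rewrite subr0.
  by rewrite -(mulr0 q); apply: cvgMl_tmp; exact/cvg_nrP.
have WE : W = h *: (t + W * W).
  apply: bop_ext => x; rewrite bopZE bopDE bopME.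
  have Y1 : (fun k => Y k.+1 x) @ \oo --> W x.
    by have := WY x; rewrite -(cvg_shiftS (fun k => Y k x)).
  apply: (lim_uniq Y1).
  under eq_fun do rewrite YS bopZE bopDE bopME.
  by apply: cvgZl_tmp; apply: cvgD => //; exact: cvg_cst.
have Wsa : adj W = W.
  apply: adj_uniq => x y.
  apply: (lim_uniqC (cvg_innerl (y := y) (WY x))).
  have -> : (fun k => inner (Y k x) y) = (fun k => inner x (Y k y)).
    by apply/funext => k; rewrite adjE Ysa.
  exact: cvg_innerr.
exists (1 - W); rewrite adjB adj1 Wsa mulrBl mul1r mulrBr mulr1.
have : W + W = t + W * W.
  rewrite {1 2}WE -scalerDl -[RHS]scale1r; congr (_ *: _).
  by rewrite /h -rmorphD -(rmorph1 (real_complex R)); congr _%:C; lra.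
move=> e; have -> : t = W + W - W * W by rewrite e addrK.
by rewrite -[RHS]addrA -opprD addrA.
Qed.

End SquareRoot.

Section States.
Context {R : realType} {H : hilbertType R}.
Local Notation C := R[i].
Context (phi : {linear bop H -> C^o}) (phiP : is_state phi).
Implicit Types S T P : bop H.

Lemma state_form : psd_form [set: bop H] (fun S T => phi (adj T * S)).
Proof.
split=> [a x y z _ _ _|a x y z _ _ _|x _]; last exact: phiP.1.
  by rewrite mulrDr bopZMr linearP.
by rewrite adjD adjZ mulrDl bopZMl linearP.
Qed.

(** [is_state] speaks of the operators [adj T * T] only. If 0 <= P <= B, then P + e = c (1 - t) with
    c = B/2 + e and t = (B/2 - P)/c of norm at most (B/2)/c < 1, so [sqrt_one_minus] puts P + e into
    that form; then e tends to 0. *)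
Lemma state_psd_ge0 P : psd_op P -> 0 <= phi P.
Proof.
move=> P0; have [B' B'0 hB'] := bl_bound (bopP P).
pose B := B' + 1; have B0 : 0 < B by rewrite ltr_wpDl.
have hB x : nr (P x) <= B * nr x.
  by rewrite (le_trans (hB' x))// ler_wpM2r ?nr_ge0// lerDl.
(* P^2 <= B P, which is what bounds B/2 - P by B/2. *)
have sqP x : nr (P x) ^+ 2 <= B * complex.Re (inner (P x) x).
  have := psd_CS (subspace_setT H) (psd_op_form P0) (x := x) (y := P x) I I.
  rewrite inner_nr nrR ger0_norm ?sqr_ge0// => h1.
  have h2 : complex.Re (inner (P (P x)) (P x)) <= B * nr (P x) ^+ 2.
    rewrite (le_trans (ler_norm _))// (le_trans (Re_nr _))//.
    by rewrite (le_trans (inner_CS _ _))// expr2 mulrA ler_wpM2r// nr_ge0.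
  have h3 : 0 <= complex.Re (inner (P x) x) by have := P0 x; rewrite lecE => /andP[].
  have [->|n0] := eqVneq (nr (P x)) 0; first by rewrite expr0n mulr_ge0// ltW.
  have n2 : 0 < nr (P x) ^+ 2 by rewrite exprn_gt0// lt_neqAle eq_sym n0 nr_ge0.
  rewrite -(ler_pM2l n2) -expr2 (le_trans h1)// mulrC mulrA ler_wpM2r//.
  by rewrite mulrC.
have He (e : R) : 0 < e -> 0 <= phi P + e%:C.
  move=> e0.
  pose c := B / 2 + e; have c0 : 0 < c by rewrite addr_gt0// divr_gt0.
  pose t : bop H := c^-1%:C *: ((B / 2)%:C *: (1 : bop H) - P).
  have [||||S SE] := @sqrt_one_minus R H t (B / 2 / c).
  - by rewrite !mulr_ge0 ?invr_ge0// ltW.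
  - by rewrite ltr_pdivrMr// mul1r ltrDl.
  - rewrite /t adjZ adjB adjZ adj1 (psd_op_adj P0).
    by rewrite !conjR.
  - move=> x; rewrite /t bopZE bopBE bopZE bop1E nrZ nrR ger0_norm ?invr_ge0 ?(ltW c0)//.
    rewrite [X in _ <= X * _]mulrC -mulrA ler_wpM2l ?invr_ge0 ?(ltW c0)//.
    rewrite -(@ler_pXn2r _ 2) ?nnegrE ?mulr_ge0 ?nr_ge0 ?divr_ge0 ?(ltW B0)//.
    rewrite nrB_sqr nrZ nrR ger0_norm ?divr_ge0 ?(ltW B0)// innerZl ReZ inner_sym.
    rewrite ReJ; have := sqP x; lra.
  have : P + e%:C *: (1 : bop H) = c%:C *: (1 - t).
    rewrite scalerBr /t scalerA -rmorphM/= divff ?gt_eqF// scale1r.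
    by rewrite opprB addrCA -scalerBl -rmorphB/= /c [B / 2 + e]addrC addrK.
  move=> e1; have := congr1 phi e1; rewrite linearD linearZ/= phiP.2 SE linearZ/=.
  rewrite /GRing.scale/= mulr1 => ->.
  by rewrite mulr_ge0 ?ler0c ?(ltW c0)//; exact: phiP.1.
have [h1 h2] : complex.Im (phi P) = 0 /\ forall e, 0 < e -> 0 <= complex.Re (phi P) + e.
  split=> [|e e0].
    by have := He 1 ltr01; rewrite lecE ImD /= addr0 => /andP[/eqP].
  by have := He e e0; rewrite lecE ReD /= => /andP[].
rewrite lecE h1 eqxx/=; rewrite leNgt; apply/negP => h.
have := h2 (- complex.Re (phi P) / 2); rewrite divr_gt0 ?oppr_gt0// => /(_ isT); lra.
Qed.

(** Cauchy-Schwarz against [1], and positivity of B^2 - T^* T. *)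
Lemma state_le1 T (B : R) : 0 <= B -> (forall x, nr (T x) <= B * nr x) ->
  nr (phi T) <= B.
Proof.
move=> B0 hB; rewrite -(@ler_pXn2r _ 2) ?nnegrE ?nr_ge0//.
have := psd_CS (subspace_setT _) state_form (x := T) (y := 1) I I.
rewrite adj1 mul1r mulr1 phiP.2 mulr1 => h; rewrite (le_trans h)//.
have : psd_op ((B ^+ 2)%:C *: (1 : bop H) - adj T * T).
  move=> x; rewrite bopBE bopZE bop1E bopME innerBl innerZl adjE' !inner_nr.
  rewrite -rmorphM -rmorphB ler0c subr_ge0 -exprMn ler_pXn2r ?nnegrE ?nr_ge0//.
  by rewrite mulr_ge0 ?nr_ge0.
move=> /state_psd_ge0; rewrite linearB linearZ/= phiP.2 /GRing.scale/= mulr1.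
by rewrite lecE => /andP[_]; rewrite ReB subr_ge0.
Qed.

End States.

(** * The Hilbert space of square-summable sequences *)

Section SquareSummable.
Context {R : realType} (H : hilbertType R).
Local Notation C := R[i].

Definition sqsum (f : nat -> H) (n : nat) : R := \sum_(0 <= i < n) nr (f i) ^+ 2.

Lemma sqsum_ge0 f n : 0 <= sqsum f n.
Proof. by apply: sumr_ge0 => i _; rewrite sqr_ge0. Qed.

Lemma sqsumS f n : sqsum f n.+1 = sqsum f n + nr (f n) ^+ 2.
Proof. by rewrite /sqsum big_nat_recr. Qed.

Lemma sqsum_nondecreasing f : nondecreasing_seq (sqsum f).
Proof.
by apply/nondecreasing_seqP => n; rewrite sqsumS lerDl sqr_ge0.
Qed.

(** Bounded partial sums rather than a convergent series: this is what survives coordinatewise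
    limits. *)
Definition square_summable : {pred (nat -> H)} :=
  fun f => `[< exists B, forall n, sqsum f n <= B >].

Lemma square_summable_submod_closed : submod_closed square_summable.
Proof.
split=> [|a f g /asboolP[B hB] /asboolP[D hD]]; apply/asboolP.
  exists 0 => n; rewrite /sqsum big1// => i _.
  by rewrite (_ : (0 : nat -> H) i = 0)// nr0 expr0n.
exists (2 * nr a ^+ 2 * B + 2 * D) => n.
apply: (@le_trans _ _ (2 * nr a ^+ 2 * sqsum f n + 2 * sqsum g n)); last first.
  by rewrite lerD// ler_wpM2l// mulr_ge0// sqr_ge0.
rewrite /sqsum !big_distrr -big_split/=; apply: ler_sum => i _.
have := parallelogram (a *: f i) (g i); rewrite nrZ exprMn => h.
have := sqr_ge0 (nr (a *: f i - g i)).
have -> : (a *: f + g) i = a *: f i + g i by [].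
by rewrite -mulrA => h'; lra.
Qed.

HB.instance Definition _ := GRing.isSubmodClosed.Build R[i] (nat -> H)
  square_summable square_summable_submod_closed.

Record l2 := L2 { l2_fun :> nat -> H ; l2_funP : l2_fun \in square_summable }.

HB.instance Definition _ := [isSub for l2_fun].
HB.instance Definition _ := [Choice of l2 by <:].
HB.instance Definition _ := [SubChoice_isSubLmodule of l2 by <:].

Lemma l2DE (f g : l2) i : (f + g) i = f i + g i. Proof. by []. Qed.
Lemma l2ZE (a : C) (f : l2) i : (a *: f) i = a *: f i. Proof. by []. Qed.
Lemma l2NE (f : l2) i : (- f) i = - f i. Proof. by []. Qed.
Lemma l20E i : (0 : l2) i = 0. Proof. by []. Qed.

Lemma l2_ext (f g : l2) : (forall i, f i = g i) -> f = g.
Proof. by move=> h; apply: val_inj; apply/funext. Qed.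

Lemma sqsum_cvg (f : l2) : cvg (sqsum f @ \oo).
Proof.
have /asboolP[B hB] := l2_funP f.
apply: nondecreasing_is_cvgn; first exact: sqsum_nondecreasing.
by exists B => _ [n _ <-].
Qed.

Definition psum_inner (f g : nat -> H) (n : nat) : C^o :=
  \sum_(0 <= i < n) inner (f i) (g i).

(** Polarization reduces convergence of the inner product series to monotone convergence of three
    square sums. *)
Lemma Re_psum_inner (f g : l2) n : complex.Re (psum_inner f g n) =
  2^-1 * (sqsum (f + g : l2) n - sqsum f n - sqsum g n).
Proof.
have aux (A B D x y r : R) :
    2^-1 * (A - B - D) + r = 2^-1 * (A + (x + y + 2 * r) - (B + x) - (D + y)).
  by lra.
rewrite /psum_inner /sqsum; elim: n => [|n IH].
  by rewrite !big_geq// subrr subr0 mulr0.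
by rewrite !big_nat_recr// ReD IH l2DE nrD_sqr; exact: aux.
Qed.

Lemma Im_psum_inner (f g : l2) n : complex.Im (psum_inner f g n) =
  complex.Re (psum_inner f ('i%C *: g : l2) n).
Proof.
rewrite /psum_inner; elim: n => [|n IH]; first by rewrite !big_geq.
rewrite !big_nat_recr// ImD ReD IH l2ZE innerZr; congr (_ + _).
by case: (inner _ _) => a b /=; lra.
Qed.

Lemma psum_inner_cvg (f g : l2) : cvg (psum_inner f g @ \oo).
Proof.
have hRe (h k : l2) : cvg ((fun n => complex.Re (psum_inner h k n)) @ \oo).
  have -> : (fun n => complex.Re (psum_inner h k n)) =
      (fun n => 2^-1 * (sqsum (h + k : l2) n - sqsum h n - sqsum k n)).
    by apply/funext => n; rewrite Re_psum_inner.
  apply: (cvgP (2^-1 * (limn (sqsum (h + k : l2)) - limn (sqsum h) - limn (sqsum k)))).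
  apply: cvgMl_tmp; apply: cvgB; last exact: sqsum_cvg.
  by apply: cvgB; exact: sqsum_cvg.
have /cvg_ex[a ha] := hRe f g; have /cvg_ex[b hb] := hRe f ('i%C *: g).
apply/cvg_ex; exists (a +i* b); apply: cvg_complex => //.
by under eq_fun do rewrite Im_psum_inner.
Qed.

Definition l2_inner (f g : l2) : C := lim (psum_inner f g @ \oo).

Lemma l2_innerP (f g : l2) : psum_inner f g @ \oo --> (l2_inner f g : C^o).
Proof. exact: psum_inner_cvg. Qed.

Lemma l2_inner_linl (a : C) (f g h : l2) :
  l2_inner (a *: f + g) h = a * l2_inner f h + l2_inner g h.
Proof.
apply: (lim_uniqC (@l2_innerP _ _)).
have -> : psum_inner (a *: f + g : l2) h = (fun n => a * psum_inner f h n + psum_inner g h n).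
  apply/funext => n; rewrite /psum_inner big_distrr -big_split.
  by apply: eq_bigr => i _; rewrite l2DE l2ZE innerDl innerZl.
by apply: cvgD; [apply: cvgMl_tmp; exact: l2_innerP|exact: l2_innerP].
Qed.

Lemma l2_inner_sym (f g : l2) : l2_inner f g = (l2_inner g f)^*.
Proof.
apply: (lim_uniqC (@l2_innerP _ _)).
have -> : psum_inner f g = (fun n => (psum_inner g f n)^*).
  apply/funext => n; rewrite /psum_inner rmorph_sum.
  by apply: eq_bigr => i _; rewrite inner_sym.
by apply: cvg_conj; exact: l2_innerP.
Qed.

Lemma l2_inner_linr (a : C) (f g h : l2) :
  l2_inner h (a *: f + g) = a^* * l2_inner h f + l2_inner h g.
Proof.
by rewrite l2_inner_sym l2_inner_linl rmorphD rmorphM/= -!l2_inner_sym.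
Qed.

Lemma l2_inner_sqsum (f : l2) : l2_inner f f = (limn (sqsum f))%:C.
Proof.
apply: (lim_uniqC (@l2_innerP _ _)); apply: cvg_complex; last first.
  apply: cvg_near_cst; apply: nearW => n; rewrite /psum_inner.
  elim: n => [|n IH]; first by rewrite big_geq.
  by rewrite big_nat_recr// ImD IH inner_nr addr0.
have -> : (fun n => complex.Re (psum_inner f f n)) = sqsum f.
  apply/funext => n; rewrite /psum_inner /sqsum.
  elim: n => [|n IH]; first by rewrite !big_geq.
  by rewrite !big_nat_recr// ReD IH inner_nr.
exact: sqsum_cvg.
Qed.

Lemma sqsum_le_lim (f : l2) n : sqsum f n <= limn (sqsum f).
Proof.
by apply: nondecreasing_cvgn_le; [exact: sqsum_nondecreasing|exact: sqsum_cvg].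
Qed.

Lemma l2_inner_psd : psd_form [set: l2] l2_inner.
Proof.
split=> *; [exact: l2_inner_linl|exact: l2_inner_linr|].
by rewrite l2_inner_sqsum ler0c (le_trans (sqsum_ge0 _ 0) (sqsum_le_lim _ 0)).
Qed.

Lemma l2_inner_eq0 (f : l2) : l2_inner f f = 0 -> f = 0.
Proof.
rewrite l2_inner_sqsum -[0](rmorph0 (real_complex R)) => /complexI f0.
apply: l2_ext => i; rewrite l20E; apply/eqP.
rewrite -(@nr_eq0 R) -sqrf_eq0 eq_le sqr_ge0 andbT.
have := sqsum_le_lim f i.+1; rewrite f0 sqsumS.
by apply: le_trans; rewrite lerDr sqsum_ge0.
Qed.

HB.instance Definition _ := bilinear_isBilinear.Build C l2 l2 C
  *%R ((@conjC C) \; *%R) l2_inner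
  (pair (fun h a f g => l2_inner_linl a f g h) (fun h a f g => l2_inner_linr a f g h)).

Lemma l2_inner_herm f g : l2_inner f g = (-1) ^+ false * conjC (l2_inner g f).
Proof. by rewrite mul1r -l2_inner_sym. Qed.

HB.instance Definition _ := isHermitianSesquilinear.Build C l2 false (@conjC C)
  l2_inner l2_inner_herm.

Lemma l2_inner_gt0 (f : l2) : f != 0 -> 0 < l2_inner f f.
Proof.
move=> f0; rewrite lt_neqAle (psd_ge0 l2_inner_psd)// andbT eq_sym.
by apply: contra f0 => /eqP/l2_inner_eq0->.
Qed.

HB.instance Definition _ := isDotProduct.Build C l2 l2_inner l2_inner_gt0.

Definition l2_norm (f : l2) : C := (Num.sqrt (limn (sqsum f)))%:C.

Lemma l2_sqr_norm f : l2_norm f ^+ 2 = l2_inner f f.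
Proof.
rewrite /l2_norm -rmorphXn/= sqr_sqrtr ?l2_inner_sqsum//.
exact: (le_trans (sqsum_ge0 _ 0) (sqsum_le_lim _ 0)).
Qed.

Lemma l2_norm_ge0 f : 0 <= l2_norm f.
Proof. by rewrite ler0c sqrtr_ge0. Qed.

Lemma l2_normZ (a : C) f : l2_norm (a *: f) = `|a| * l2_norm f.
Proof.
apply/eqP; rewrite -(@eqrXn2 _ 2) ?mulr_ge0 ?l2_norm_ge0//.
rewrite exprMn !l2_sqr_norm (psdZl (subspace_setT _) l2_inner_psd)//.
by rewrite (psdZr (subspace_setT _) l2_inner_psd)// mulrA normCK.
Qed.

Lemma l2_normD f g : l2_norm (f + g) <= l2_norm f + l2_norm g.
Proof.
rewrite -(@ler_pXn2r _ 2) ?nnegrE ?addr_ge0 ?l2_norm_ge0//.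
have h := psd_CS (subspace_setT _) l2_inner_psd (x := f) (y := g) I I.
have hz := psd_expand (subspace_setT _) l2_inner_psd 1 (x := f) (y := g) I I.
rewrite l2_sqr_norm -[g]scale1r hz rmorph1 !mul1r scale1r.
rewrite [l2_inner g f]l2_inner_sym addcJ.
rewrite sqrrD -!l2_sqr_norm -addrA -[leRHS]addrA lerD2l.
rewrite [leLHS]addrC [leRHS]addrC lerD2l.
have -> : l2_norm f * l2_norm g =
    (Num.sqrt (limn (sqsum f)) * Num.sqrt (limn (sqsum g)))%:C by rewrite rmorphM.
rewrite -[leRHS]mulr_natl ler_pM2l ?ltr0n// lecR.
rewrite (le_trans (ler_norm _))// (le_trans (Re_nr _))//.
rewrite -(@ler_pXn2r _ 2) ?nnegrE ?mulr_ge0 ?nr_ge0 ?sqrtr_ge0// (le_trans h)//.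
by rewrite !l2_inner_sqsum/= exprMn !sqr_sqrtr// (le_trans (sqsum_ge0 _ 0) (sqsum_le_lim _ 0)).
Qed.

Lemma l2_norm_eq0 f : l2_norm f = 0 -> f = 0.
Proof. by move=> f0; apply: l2_inner_eq0; rewrite -l2_sqr_norm f0 expr0n. Qed.

HB.instance Definition _ := Lmodule_isNormed.Build C l2 l2_normD l2_normZ l2_norm_eq0.

Lemma nr_l2E (f : l2) : nr f = Num.sqrt (limn (sqsum f)).
Proof. by []. Qed.

Lemma sqr_nr_l2 (f : l2) : nr f ^+ 2 = limn (sqsum f).
Proof.
by rewrite nr_l2E sqr_sqrtr// (le_trans (sqsum_ge0 _ 0) (sqsum_le_lim _ 0)).
Qed.

Lemma sqsum_le_nr (f : l2) n : sqsum f n <= nr f ^+ 2.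
Proof. by rewrite sqr_nr_l2 sqsum_le_lim. Qed.

Lemma nr_l2_le (f : l2) (B : R) : 0 <= B ->
  (forall n, sqsum f n <= B ^+ 2) -> nr f <= B.
Proof.
move=> B0 hB; rewrite -(@ler_pXn2r _ 2) ?nnegrE ?nr_ge0// sqr_nr_l2.
by apply: limr_le; [exact: sqsum_cvg|exact: nearW].
Qed.

Lemma nr_coord (f : l2) i : nr (f i) <= nr f.
Proof.
rewrite -(@ler_pXn2r _ 2) ?nnegrE ?nr_ge0//.
rewrite (le_trans _ (sqsum_le_nr f i.+1))// sqsumS lerDr sqsum_ge0//.
Qed.

(** Coordinates converge by completeness of [H]; the Cauchy bound passes to the limit in each
    partial sum, which involves finitely many coordinates. *)
Lemma l2_complete (F : set_system l2) : ProperFilter F -> cauchy F -> cvg F.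
Proof.
move=> FF /(cauchyP F) Fc.
have small (e : R) : 0 < e -> exists2 A, F A & forall f g, A f -> A g -> nr (f - g) < e.
  move=> e0; have e2 : 0 < (e / 2)%:C :> C by rewrite ltcR divr_gt0.
  have [x Fx] := Fc _ e2; exists (ball x (e / 2)%:C) => // f g.
  rewrite -ball_normE /ball_ /= !nrE !ltcR => hf hg.
  by rewrite -(subrKA x) (le_lt_trans (nrD _ _))// (splitr e) ltrD// nr_dist.
have /choice[g gP] : forall i : nat, exists x : H, (fun f : l2 => f i) @ F --> x.
  move=> i; apply/cvg_ex; apply/cauchy_cvgP; apply/cauchyP => e e0.
  have eE : e = (complex.Re e)%:C by rewrite RRe_real// realE ltW.
  have /small[A FA hA] : 0 < complex.Re e by rewrite -ltcR -eE.
  have [f Af] := filter_ex FA; exists (f i).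
  apply: (@filterS _ F _ A _ _ FA) => h Ah; rewrite /= -ball_normE /ball_/= nrE eE ltcR.
  by rewrite (le_lt_trans (nr_coord (f - h) i))// hA.
have key (e : R) A f : 0 < e -> F A -> (forall f g, A f -> A g -> nr (f - g) < e) ->
    A f -> forall n, sqsum (fun i => g i - f i) n <= e ^+ 2.
  move=> e0 FA hA Af n.
  have cv : (fun h : l2 => sqsum (fun i => h i - f i) n) @ F -->
      sqsum (fun i => g i - f i) n.
    rewrite /sqsum; apply: cvg_big => //; first exact: add_continuous.
    move=> i _; rewrite [X in _ --> X]expr2; under eq_fun do rewrite expr2.
    by apply: cvgM; apply: cvg_nr; apply: cvgB; [exact: gP|exact: cvg_cst|
      exact: gP|exact: cvg_cst].
  apply: (cvgr_to_le cv); apply: filterS FA => h Ah.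
  rewrite (le_trans (sqsum_le_nr (h - f) n))// ler_pXn2r ?nnegrE ?nr_ge0 ?(ltW e0)//.
  exact/ltW/hA.
have gl2 : g \in square_summable.
  have [A FA hA] := small _ ltr01; have [f Af] := filter_ex FA.
  have gf : (fun i => g i - f i) \in square_summable.
    by apply/asboolP; exists (1 ^+ 2) => n; apply: (key 1 A f).
  have -> : g = (L2 gf + f : l2) by apply/funext => i /=; rewrite subrK.
  exact: l2_funP.
apply/cvg_ex; exists (L2 gl2).
apply/cvgrPdist_le => e e0.
have eE : e = (complex.Re e)%:C by rewrite RRe_real// realE ltW.
have er0 : 0 < complex.Re e by rewrite -ltcR -eE.
have [A FA hA] := small _ er0.
apply: (filterS _ (FA)) => f Af; rewrite nrE eE lecR.
by apply: nr_l2_le; [exact: ltW|move=> n; exact: (key _ A f er0 FA hA Af n)].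
Qed.

HB.instance Definition _ := Uniform_isComplete.Build l2 l2_complete.

Lemma l2_inner_norm (f : l2) : l2_inner f f = `|f| ^+ 2.
Proof. by rewrite -l2_sqr_norm. Qed.

HB.instance Definition _ := isHilbert.Build R l2 l2_inner_norm.

End SquareSummable.

(** * Amplifications *)

Section Amplification.
Context {R : realType} {H : hilbertType R}.
Local Notation C := R[i].
Implicit Types S T : bop H.

Lemma coord_bounded_linear i : bounded_linear (fun f : l2 H => f i).
Proof.
by split=> [a f g//|]; exists 1 => f; rewrite mul1r nr_coord.
Qed.

Lemma sqsum_bop T (B : R) (f : nat -> H) n : 0 <= B ->
  (forall x, nr (T x) <= B * nr x) ->
  sqsum (fun i => T (f i)) n <= B ^+ 2 * sqsum f n.
Proof.
move=> B0 hB; rewrite /sqsum big_distrr; apply: ler_sum => i _ /=.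
by rewrite -exprMn ler_pXn2r ?nnegrE ?mulr_ge0 ?nr_ge0.
Qed.

Lemma amp_subproof T (f : l2 H) : (fun i => T (f i)) \in @square_summable R H.
Proof.
have [B B0 hB] := bl_bound (bopP T).
apply/asboolP; exists (B ^+ 2 * nr f ^+ 2) => n.
by rewrite (le_trans (sqsum_bop _ _ B0 hB))// ler_wpM2l ?sqr_ge0// sqsum_le_nr.
Qed.

Definition amp_fun T (f : l2 H) : l2 H := L2 (amp_subproof T f).

Lemma nr_amp_fun T (B : R) : 0 <= B -> (forall x, nr (T x) <= B * nr x) ->
  forall f, nr (amp_fun T f) <= B * nr f.
Proof.
move=> B0 hB f; apply: nr_l2_le => [|n]; first by rewrite mulr_ge0 ?nr_ge0.
rewrite (le_trans (sqsum_bop _ _ B0 hB))// exprMn ler_wpM2l ?sqr_ge0//.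
exact: sqsum_le_nr.
Qed.

Lemma amp_bounded_linear T : bounded_linear (amp_fun T).
Proof.
split=> [a f g|]; first by apply: l2_ext => i; rewrite /= bopD bopZ.
have [B B0 hB] := bl_bound (bopP T); exists B; exact: nr_amp_fun.
Qed.

(** The tensor product of [T] with the identity of the scalar sequence space. *)
Definition amp T : bop (l2 H) := Bop (bounded_linear_op (amp_bounded_linear T)).

Lemma ampE T (f : l2 H) i : amp T f i = T (f i). Proof. by []. Qed.

Lemma amp1 : amp 1 = 1.
Proof. by apply: bop_ext => f; apply: l2_ext. Qed.

Lemma ampM S T : amp (S * T) = amp S * amp T.
Proof. by apply: bop_ext => f; apply: l2_ext. Qed.

Lemma amp_lin (a : C) S T : amp (a *: S + T) = a *: amp S + amp T.
Proof. by apply: bop_ext => f; apply: l2_ext. Qed.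

Lemma inner_l2P (f g : l2 H) :
  (fun n => \sum_(0 <= i < n) inner (f i) (g i) : C^o) @ \oo --> (inner f g : C^o).
Proof. exact: l2_innerP. Qed.

Lemma amp_adj T : amp (adj T) = adj (amp T).
Proof.
apply/esym/adj_uniq => f g; apply: (lim_uniqC (@inner_l2P _ _)).
under eq_fun do under eq_bigr do rewrite ampE adjE -ampE.
exact: inner_l2P.
Qed.

Lemma single_subproof j (x : H) :
  (fun i => if i == j then x else 0) \in @square_summable R H.
Proof.
apply/asboolP; exists (nr x ^+ 2) => n; rewrite /sqsum big_mkord.
have -> : \sum_(i < n) nr (if i == j :> nat then x else 0 : H) ^+ 2 =
    \sum_(i < n | i == j :> nat) nr x ^+ 2.
  rewrite [RHS]big_mkcond; apply: eq_bigr => i _.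
  by case: ifP => // _; rewrite nr0 expr0n.
have [jn|nj] := ltnP j n.
  by rewrite (big_pred1 (Ordinal jn))// => i.
rewrite big_pred0 ?sqr_ge0// => i; apply/negbTE.
by rewrite neq_ltn (leq_trans (ltn_ord i) nj).
Qed.

Definition single j (x : H) : l2 H := L2 (single_subproof j x).

Lemma singleE j x i : single j x i = if i == j then x else 0.
Proof. by []. Qed.

Lemma amp_single T j x : amp T (single j x) = single j (T x).
Proof.
by apply: l2_ext => i; rewrite ampE !singleE; case: ifP => // _; rewrite bop0.
Qed.

Lemma sum_singleE (s : nat -> H) n i :
  (\sum_(0 <= j < n) single j (s j)) i = if (i < n)%N then s i else 0.
Proof.
elim: n => [|n IH]; first by rewrite big_geq.
rewrite big_nat_recr// l2DE IH singleE ltnS.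
have [->|ni] := eqVneq i n; first by rewrite ltnn leqnn add0r.
by rewrite addr0 ltn_neqAle ni.
Qed.

Lemma nr_single j x : nr (single j x) = nr x.
Proof.
apply/eqP; rewrite eq_le; apply/andP; split; last first.
  by have := nr_coord (single j x) j; rewrite singleE eqxx.
apply: nr_l2_le => [|n]; first exact: nr_ge0.
elim: n => [|n IH]; first by rewrite /sqsum big_geq// sqr_ge0.
rewrite sqsumS singleE; have [nj|nj] := eqVneq n j; last first.
  by rewrite nr0 expr0n addr0.
rewrite gerDr /sqsum big_nat big1// => i /andP[_].
by rewrite singleE nj => ij; rewrite ltn_eqF// nr0 expr0n.
Qed.

Lemma single_bounded_linear j : bounded_linear (single j).
Proof.
split=> [a x y|]; last by exists 1 => x; rewrite nr_single mul1r.
apply: l2_ext => i; rewrite l2DE l2ZE !singleE; case: ifP => // _.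
by rewrite scaler0 addr0.
Qed.

Lemma sum_single_cvg (f : l2 H) :
  (fun n => \sum_(0 <= j < n) single j (f j)) @ \oo --> f.
Proof.
apply/cvg_nrP/cvgrPdist_le => e e0.
have := @sqsum_cvg _ _ f; move=> /cvgrPdist_le/(_ (e ^+ 2) (exprn_gt0 2 e0)).
apply: filterS => n hn; rewrite sub0r normrN ger0_norm ?nr_ge0//.
rewrite nr_dist; apply: nr_l2_le => [|m]; first exact: ltW.
have hnm : sqsum (f - \sum_(0 <= j < n) single j (f j) : l2 H) m <=
    `|limn (sqsum f) - sqsum f n|; last exact: (le_trans hnm).
rewrite ger0_norm ?subr_ge0 ?sqsum_le_lim// lerBrDr.
apply: (le_trans _ (sqsum_le_lim f (maxn m n))).
apply: (@le_trans _ _ (sqsum (f - \sum_(0 <= j < n) single j (f j) : l2 H) (maxn m n) + sqsum f n)).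
  by rewrite lerD2r sqsum_nondecreasing// leq_maxl.
rewrite /sqsum (big_cat_nat (leq0n n) (leq_maxr m n)).
rewrite [leRHS](big_cat_nat (leq0n n) (leq_maxr m n)).
rewrite [X in X + _ + _]big_nat [X in X + _ + _]big1 ?add0r => [|i /andP[_ ni]]; last first.
  by rewrite l2DE l2NE sum_singleE ni subrr nr0 expr0n.
rewrite addrC lerD2l [leLHS]big_nat [leRHS]big_nat le_eqVlt; apply/orP; left.
apply/eqP/eq_bigr => i /andP[ni _].
by rewrite l2DE l2NE sum_singleE ltnNge ni subr0.
Qed.

Lemma l2_cvg0 (f : l2 H) : (fun n => f n) @ \oo --> (0 : H).
Proof.
have h1 := @sqsum_cvg _ _ f.
have h2 : (fun n => sqsum f n.+1 - sqsum f n) @ \oo --> (0 : R).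
  rewrite -(subrr (limn (sqsum f))); apply: cvgB => //.
  by rewrite (cvg_shiftS (sqsum f)).
apply/cvg_nrP/cvgrPdist_lt => e e0.
have /cvgrPdist_lt/(_ _ (exprn_gt0 2 e0)) := h2; apply: filterS => n.
rewrite !sub0r !normrN subr0 sqsumS addrAC subrr add0r !ger0_norm ?sqr_ge0 ?nr_ge0//.
by rewrite ltr_pXn2r ?nnegrE ?nr_ge0 ?(ltW e0).
Qed.

Definition norm_bounded_by (B : R) (T_ : nat -> bop H) :=
  forall n x, nr (T_ n x) <= B * nr x.

End Amplification.

Section Representations.
Context {R : realType}.
Local Notation C := R[i].

Definition intertwiner (H K : hilbertType R) (pi : bop H -> bop K) (c : K -> H) :=
  bounded_linear c /\ forall T v, c (pi T v) = T (c v).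

(* Such a [pi] is a multiple of the identity representation; separation by
   intertwiners replaces normality. *)
Record amplification (H K : hilbertType R) (pi : bop H -> bop K) : Prop := {
  repr1 : pi 1 = 1 ;
  reprM : forall S T, pi (S * T) = pi S * pi T ;
  repr_lin : forall (a : C) S T, pi (a *: S + T) = a *: pi S + pi T ;
  repr_adj : forall T, pi (adj T) = adj (pi T) ;
  repr_bound : forall (B : R) (T : bop H), 0 <= B -> (forall x, nr (T x) <= B * nr x) ->
    forall v, nr (pi T v) <= B * nr v ;
  repr_separated : forall v : K, (forall c, intertwiner pi c -> c v = 0) -> v = 0 ;
  repr_sot : forall (B : R) (T_ : nat -> bop H), 0 <= B -> norm_bounded_by B T_ ->
    (forall x, (fun n => T_ n x) @ \oo --> (0 : H)) ->
    forall v, (fun n => pi (T_ n) v) @ \oo --> (0 : K) }.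

Lemma amp_amplification (H : hilbertType R) : amplification (@amp R H).
Proof.
split.
- exact: amp1.
- exact: ampM.
- exact: amp_lin.
- exact: amp_adj.
- by move=> B T B0 hB v; exact: nr_amp_fun.
- move=> f hf; apply: l2_ext => i; apply: (hf (fun g => g i)).
  by split=> //; exact: coord_bounded_linear.
(* On a truncation of [f] to finitely many coordinates the assumed strong convergence applies; the
   bound [B] controls the tail uniformly in the index. *)
- move=> B T_ B0 TB T0 f; apply/cvg_nrP/cvgrPdist_lt => e e0.
  have e2 : 0 < e / 2 by rewrite divr_gt0.
  have B1 : 0 < B + 1 by rewrite ltr_wpDl.
  have [n _ hn] : \forall n \near \oo,
      nr (\sum_(0 <= j < n) single j (f j) - f) < e / 2 / (B + 1).
    have /cvg_nrP/cvgrPdist_lt/(_ _ (divr_gt0 e2 B1)) := @sum_single_cvg R H f.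
    by apply: filterS => n; rewrite sub0r normrN ger0_norm ?nr_ge0.
  have {}hn := hn n (leqnn n).
  have : (fun k => nr (\sum_(0 <= j < n) single j (T_ k (f j)))) @ \oo --> (0 : R).
    rewrite -(@nr0 R (l2 H)); apply: cvg_nr.
    rewrite -[X in _ --> X](_ : \sum_(0 <= j < n) single j (0 : H) = 0); last first.
      by rewrite big1// => j _; rewrite (bl0 (single_bounded_linear j)).
    apply: cvg_big => //; first exact: add_continuous.
    by move=> j _; apply: (bl_cvg (single_bounded_linear j)).
  move=> /cvgrPdist_lt/(_ _ e2); apply: filterS => k.
  rewrite !sub0r !normrN !ger0_norm ?nr_ge0// subr0 => hk.
  have -> : amp (T_ k) f = \sum_(0 <= j < n) single j (T_ k (f j)) -
      amp (T_ k) (\sum_(0 <= j < n) single j (f j) - f).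
    rewrite bopB (bl_sum (bopP _)); under [in RHS]eq_bigr do rewrite -amp_single.
    by rewrite opprB addrC subrK.
  rewrite (le_lt_trans (nrB _ _))// (splitr e) ltrD//.
  apply: (le_lt_trans (nr_amp_fun B0 (TB k) _)).
  move: hn; rewrite ltr_pdivlMr// mulrC; apply: le_lt_trans.
  by rewrite ler_wpM2r ?nr_ge0// lerDl.
Qed.

Lemma comp_amplification (H K L : hilbertType R) (pi : bop H -> bop K)
    (rho : bop K -> bop L) :
  amplification pi -> amplification rho -> amplification (rho \o pi).
Proof.
move=> hp hr; split => /=.
- by rewrite (repr1 hp) (repr1 hr).
- by move=> S T; rewrite (reprM hp) (reprM hr).
- by move=> a S T; rewrite (repr_lin hp) (repr_lin hr).
- by move=> T; rewrite (repr_adj hp) (repr_adj hr).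
- by move=> B T B0 hB; apply: (repr_bound hr) => //; exact: (repr_bound hp).
- move=> v hv; apply: (repr_separated hr) => c [cP cr].
  apply: (repr_separated hp) => d [dP dp].
  apply: (hv (d \o c)); split; first exact: bl_comp.
  by move=> T w /=; rewrite cr dp.
- move=> B T_ B0 TB T0 v; apply: (@repr_sot _ _ _ hr B) => //.
    by move=> n; exact: (repr_bound hp).
  by move=> x; apply: (@repr_sot _ _ _ hp B).
Qed.

End Representations.

(** * The bicommutant theorem *)

Lemma initial_cvg (S : choiceType) (T : topologicalType) (f : S -> T)
    (F : set_system S) {FF : Filter F} (s : S) :
  f @ F --> f s -> F --> (s : initial_topology f).
Proof.
move=> h A [B [[D oD <-] Ds] BA]; apply: (filterS BA).
by apply: h; apply: open_nbhs_nbhs.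
Qed.

Lemma initial_ptws_cvg (S : choiceType) (I : Type) (V : topologicalType)
    (f : S -> {ptws I -> V}) (F : set_system S) {FF : Filter F} (s : S) :
  (forall i, (fun x => f x i) @ F --> f s i) -> F --> (s : initial_topology f).
Proof.
move=> h; apply: initial_cvg; apply/cvg_sup => i.
by apply: (initial_cvg (f := fun g : I -> V => g i)); exact: h.
Qed.

Section Bicommutant.
Context {R : realType} {H : hilbertType R}.
Local Notation C := R[i].
Implicit Types (M : set (bop H)) (S T : bop H).

Definition commutant M : set (bop H) := [set S | forall m, M m -> S * m = m * S].

Section VonNeumannSet.
Context M (vM : von_neumann M).

Lemma vn_subspace : subspace_set M.
Proof.
split; last exact: von_neumann_lin vM.
have := von_neumann_lin vM (-1) (von_neumann1 vM) (von_neumann1 vM).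
by rewrite scaleN1r addrC subrr.
Qed.

Lemma vn0 : M 0. Proof. exact: vn_subspace.1. Qed.

Lemma vnB S T : M S -> M T -> M (S - T). Proof. exact: (subspaceB vn_subspace). Qed.

Lemma vnZ a T : M T -> M (a *: T). Proof. by move=> MT; exact: (subspaceZ vn_subspace a MT). Qed.

Lemma vnM S T : M S -> M T -> M (S * T). Proof. exact: (von_neumannM vM). Qed.

Lemma vn_adj T : M T -> M (adj T). Proof. exact: (von_neumann_adj vM). Qed.

Lemma vn_adjM S T : M S -> M T -> M (adj S * T).
Proof. by move=> MS MT; apply: vnM => //; exact: vn_adj. Qed.

End VonNeumannSet.

Lemma commutant_adj M S : von_neumann M -> commutant M S -> commutant M (adj S).
Proof.
move=> vM cS m Mm; apply: (can_inj (@adjK R H)).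
by rewrite !adjM adjK cS//; exact: von_neumann_adj vM _ Mm.
Qed.

(* Von Neumann's amplification argument: [amp T] commutes with the projection
   onto the closure of [amp M v] for each finitely supported [v]. *)
Lemma bicommutant_approx M T (s : seq H) (e : R) : von_neumann M ->
  commutant (commutant M) T -> 0 < e ->
  exists2 m, M m & forall x, x \in s -> nr ((T - m) x) < e.
Proof.
move=> vM cT e0; pose v : l2 H := \sum_(0 <= j < size s) single j (nth 0 s j).
pose D := [set amp m v | m in M].
have sD : subspace_set D.
  split; first by exists 0; [exact: vn0|apply: l2_ext => i; rewrite ampE bop0E].
  move=> a _ _ [m Mm <-] [n Mn <-]; exists (a *: m + n).
    exact: von_neumann_lin vM _ _ _ Mm Mn.
  by rewrite amp_lin.
have [P DP] := projection sD.
have Dm m d : M m -> D d -> D (amp m d).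
  move=> Mm [n Mn <-]; exists (m * n); first exact: von_neumannM vM _ _ Mm Mn.
  by rewrite ampM.
have Pm m : M m -> P * amp m = amp m * P.
  move=> Mm; apply: (projects_on_comm DP) => d Dd; first exact: Dm.
  by rewrite -amp_adj; apply: Dm => //; exact: von_neumann_adj vM _ Mm.
have blP i j : bounded_linear (fun x => P (single j x) i).
  apply: (bl_comp (g := fun f : l2 H => f i)); last exact: coord_bounded_linear.
  by apply: bl_comp (bopP P); exact: single_bounded_linear.
(* The matrix entries of [P] lie in the commutant of [M], so [T] commutes with each of them. *)
pose P_ i j : bop H := Bop (bounded_linear_op (blP i j)).
have cP i j : commutant M (P_ i j).
  move=> m Mm; apply: bop_ext => x; rewrite !bopME /= -amp_single.
  by rewrite -[P (amp m _)]bopME Pm.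
have Pv : P v = v.
  apply: (projects_on_id DP); exists 1; first exact: von_neumann1 vM.
  by rewrite amp1.
have PT : P (amp T v) = amp T v.
  rewrite -[in RHS]Pv; apply: l2_ext => i; rewrite ampE {1 2}/v.
  rewrite !(bl_sum (bopP _)) !(bl_sum (coord_bounded_linear i)) (bl_sum (bopP T)).
  apply: eq_bigr => j _; rewrite amp_single.
  exact: (congr1 (fun A : bop H => A (nth 0 s j)) (esym (cT _ (cP i j)))).
have [w Dw wTv] := DP.1 (amp T v).
have /cvg_nrP/cvgrPdist_lt/(_ e e0)[k _ hk] := wTv.
have [m Mm mE] := Dw k; exists m => // x /(nthP 0)[j js <-].
have := hk k (leqnn k); rewrite /= sub0r normrN ger0_norm ?nr_ge0//.
apply: le_lt_trans; rewrite PT -mE nr_dist.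
apply: (le_trans _ (nr_coord _ j)); rewrite l2DE l2NE !ampE.
by rewrite /v sum_singleE js.
Qed.

(** The approximants of [bicommutant_approx] form a filter, indexed by a finite list of vectors and
    a tolerance, since nothing here makes sequences sufficient; it converges weakly to [T], and [M]
    is weakly closed. *)
Lemma bicommutant M T : von_neumann M -> commutant (commutant M) T -> M T.
Proof.
move=> vM cT.
pose A (p : seq H * R) : set (bop H) :=
  [set m | M m /\ forall x, x \in p.1 -> nr ((T - m) x) < p.2].
pose F := filter_from [set p : seq H * R | 0 < p.2] A.
have FF : ProperFilter F.
  apply: filter_from_proper; last first.
    by move=> [s e] /= e0; have [m Mm h] := bicommutant_approx s vM cT e0; exists m.
  apply: filter_from_filter; first by exists ([::], 1) => /=.
  move=> [s e] [s' e'] /= e0 e0'; exists (s ++ s', Num.min e e').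
    by rewrite /= lt_min e0.
  move=> m [Mm /= h]; split; split => //= x xs.
    by have := h x; rewrite mem_cat xs lt_min => /(_ isT)/andP[].
  by have := h x; rewrite mem_cat xs orbT lt_min => /(_ isT)/andP[].
have FT : F --> (T : wot H).
  apply: (initial_ptws_cvg (f := @wot_map R H)) => -[x y]; rewrite /wot_map/=.
  apply: cvg_innerl; apply/cvg_nrP/cvgrPdist_lt => e e0.
  exists ([:: x], e) => //= m [Mm /= h].
  by rewrite sub0r normrN ger0_norm ?nr_ge0// nr_dist; apply: h; rewrite inE.
have FM : F M by exists ([::], 1) => //= m [].
exact: (@closed_cvg _ (wot H) F FF id M (von_neumann_closed vM) FM T FT).
Qed.

End Bicommutant.

(** * Normal traces are vector states *)

Section NormalTrace.
Context {R : realType} {H : hilbertType R}.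
Local Notation C := R[i].
Implicit Types (a b m S T : bop H).

Lemma l2seq_square_summable (x : nat -> H) : l2seq x -> x \in @square_summable R H.
Proof.
move=> /cvg_ex[l xl]; apply/asboolP.
have sE n : series (fun n => `|x n| ^+ 2) n = (sqsum x n)%:C.
  rewrite /series /sqsum /= rmorph_sum; apply: eq_bigr => i _.
  by rewrite nrE rmorphXn.
have cl : sqsum x @ \oo --> complex.Re l.
  have -> : sqsum x = (fun n => complex.Re (series (fun n => `|x n| ^+ 2) n)).
    by apply/funext => n; rewrite sE.
  exact: cvg_Re.
exists (complex.Re l) => n; rewrite -(cvg_lim _ cl)//.
apply: nondecreasing_cvgn_le; first exact: sqsum_nondecreasing.
by apply/cvg_ex; exists (complex.Re l).
Qed.

(** An ultraweak seminorm of [T] is a weak seminorm of [amp T]. *)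
Lemma uwot_mapE (p : l2pair H) : exists X Y : l2 H,
  forall T, uwot_map T p = inner (amp T X) Y.
Proof.
exists (L2 (l2seq_square_summable (svalP p).1)).
exists (L2 (l2seq_square_summable (svalP p).2)) => S.
by apply: cvg_lim => //; exact: (@inner_l2P R H (amp S _)).
Qed.

(** Continuity at 0 spelled out on a basic ultraweak neighbourhood; [{classic _}] supplies the
    equality that membership in a list requires. *)
Lemma uwot_continuous_bound (M : set (bop H)) (tau : bop H -> C^o) :
  M 0 -> tau 0 = 0 ->
  {within (M : set (uwot H)), continuous (tau : uwot H -> C^o)} ->
  exists (s : seq {classic l2pair H}) (e : R), 0 < e /\
    forall m, M m -> (forall p, p \in s -> nr (uwot_map m p) < e) -> nr (tau m) < 1.
Proof.
move=> M0 tau0 /subspace_continuousP/(_ _ M0) ct0.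
have ct : tau @ within M (nbhs ((0 : bop H) : uwot H)) --> (0 : C^o).
  by rewrite -tau0; exact: ct0.
pose A (p : seq {classic l2pair H} * R) : set (bop H) :=
  [set m | forall x, x \in p.1 -> nr (uwot_map m x) < p.2].
pose F := filter_from [set p : seq {classic l2pair H} * R | 0 < p.2] A.
have FF : Filter F.
  apply: filter_from_filter; first by exists ([::], 1) => /=.
  move=> [s e] [s' e'] /= e0 e0'; exists (s ++ s', Num.min e e').
    by rewrite /= lt_min e0.
  move=> m /= h; split => /= x xs.
    by have := h x; rewrite mem_cat xs lt_min => /(_ isT)/andP[].
  by have := h x; rewrite mem_cat xs orbT lt_min => /(_ isT)/andP[].
have F0 : F --> ((0 : bop H) : uwot H).
  apply: (initial_ptws_cvg (f := @uwot_map R H)) => p.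
  have [X [Y XY]] := uwot_mapE p.
  have -> : uwot_map 0 p = 0 :> C.
    by rewrite XY (_ : amp 0 X = 0) ?inner0l//; apply: l2_ext => i; rewrite ampE bop0E.
  apply/cvg_nrP/cvgrPdist_lt => e e0; exists ([:: p], e) => //= m h.
  by rewrite sub0r normrN ger0_norm ?nr_ge0// subr0; apply: h; rewrite inE.
have : \forall m \near within M (nbhs ((0 : bop H) : uwot H)), nr (tau m) < 1.
  have /cvg_nrP/cvgrPdist_lt/(_ _ ltr01) := ct.
  by apply: filterS => m; rewrite sub0r normrN ger0_norm ?nr_ge0// subr0.
move=> /F0[[s e] /= e0 h]; exists s, e; split=> // m Mm hm.
exact: h.
Qed.

Lemma amp2_amplification : amplification (@amp R (l2 H) \o @amp R H).
Proof. by apply: comp_amplification; exact: amp_amplification. Qed.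

(** Normality involves finitely many square-summable pairs X, Y. Listing all of them as the entries
    of one vector [z] gives |<a^* a X, Y>| = |<a X, a Y>| <= |a z|^2, so |a z|^2 < e forces tau(a^*
    a) < 1; [zeta] is z divided by the square root of e. *)
Lemma trace_dominated (M : set (bop H)) (tau : bop H -> C^o) :
  von_neumann M -> faithful_normal_tracial_state M tau ->
  exists (zeta : l2 (l2 H)), forall a, M a ->
    complex.Re (tau (adj a * a)) <= nr (amp (amp a) zeta) ^+ 2.
Proof.
move=> vM tauP.
have M0 := vn0 vM.
have tau0 : tau 0 = 0.
  have := tau_lin tauP 1 M0 M0; rewrite scaler0 addr0 mul1r => h.
  by apply: (addIr (tau 0)); rewrite -h add0r.
have [s [e [e0 hs]]] := uwot_continuous_bound M0 tau0 (tau_normal tauP).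
have /choice[XY hXY] : forall p : {classic l2pair H}, exists XY : l2 H * l2 H,
    forall T, uwot_map T p = inner (amp T XY.1) XY.2.
  by move=> p; have [X [Y h]] := uwot_mapE p; exists (X, Y).
pose L := [seq (XY p).1 | p <- s] ++ [seq (XY p).2 | p <- s].
pose z : l2 (l2 H) := \sum_(0 <= j < size L) single j (nth 0 L j).
have zL a X : X \in L -> nr (amp a X) <= nr (amp (amp a) z).
  move=> /(nthP 0)[j jL <-]; apply: (le_trans _ (nr_coord _ j)).
  by rewrite ampE /z sum_singleE jL.
have small a : M a -> nr (amp (amp a) z) ^+ 2 < e -> complex.Re (tau (adj a * a)) < 1.
  move=> Ma az; apply: (le_lt_trans (ler_norm _)); apply: (le_lt_trans (Re_nr _)).
  apply: hs; first exact: (vn_adjM vM).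
  move=> p ps; rewrite hXY ampM bopME amp_adj adjE' (le_lt_trans (inner_CS _ _))//.
  apply: le_lt_trans az; rewrite expr2 ler_pM ?nr_ge0// zL// mem_cat; apply/orP.
    by left; exact: (map_f (fun p => (XY p).1)).
  by right; exact: (map_f (fun p => (XY p).2)).
exists ((Num.sqrt e)^-1%:C *: z) => a Ma.
rewrite bopZ nrZ nrR ger0_norm ?invr_ge0 ?sqrtr_ge0// exprMn exprVn (sqr_sqrtr (ltW e0)).
set Q := nr _ ^+ 2; set t := complex.Re _.
rewrite leNgt; apply/negP => h.
have t0 : 0 < t by apply: le_lt_trans h; rewrite mulr_ge0 ?invr_ge0 ?sqr_ge0// ltW.
(* Homogeneity: [c *: a] has trace square exactly 1, while [small] makes it less than 1. *)
pose c : C := (Num.sqrt t^-1)%:C.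
have cc : c^* * c = (t^-1)%:C.
  by rewrite /c conjR -rmorphM -expr2 sqr_sqrtr// invr_ge0 ltW.
have := small (c *: a) (vnZ vM c Ma).
have -> : amp (amp (c *: a)) z = c *: amp (amp a) z.
  by apply: l2_ext => i; apply: l2_ext => j; rewrite !ampE.
rewrite nrZ exprMn /c nrR ger0_norm ?sqrtr_ge0// sqr_sqrtr ?invr_ge0 ?(ltW t0)//.
rewrite -/Q mulrC ltr_pdivrMr// mulrC -ltr_pdivrMr// mulrC.
move=> /(_ h); rewrite adjZ bopZMl bopZMr scalerA cc.
have Maa : M (adj a * a) by exact: (vn_adjM vM).
have := tau_lin tauP (t^-1)%:C Maa M0; rewrite !addr0 tau0 addr0 => ->.
by rewrite ReZ -/t mulVf ?gt_eqF// ltxx.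
Qed.

End NormalTrace.

Section RadonNikodym.
Context {R : realType} {H K : hilbertType R} (pi : bop H -> bop K).
Local Notation C := R[i].
Context (piP : amplification pi) (M : set (bop H)) (vM : von_neumann M) (zeta : K).
Implicit Types (a b : bop H) (f : bop H -> C).

Record dominated f : Prop := {
  dominated_lin : forall (c : C) a b, M a -> M b -> f (c *: a + b) = c * f a + f b ;
  dominated_ge0 : forall a, M a -> 0 <= f (adj a * a) ;
  dominated_le : forall a, M a -> complex.Re (f (adj a * a)) <= nr (pi a zeta) ^+ 2 }.

Lemma repr_linv (c : C) a b (v : K) : pi (c *: a + b) v = c *: pi a v + pi b v.
Proof. by rewrite (repr_lin piP). Qed.

Lemma dominated_form f : dominated f -> psd_form M (fun a b => f (adj b * a)).
Proof.
move=> fP; have vMM a b : M a -> M b -> M (adj a * b) by exact: (vn_adjM vM).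
split=> [c a b m Ma Mb Mm|c a b m Ma Mb Mm|a Ma]; last exact: dominated_ge0.
  by rewrite mulrDr bopZMr (dominated_lin fP)//; exact: vMM.
by rewrite adjD adjZ mulrDl bopZMl (dominated_lin fP)//; exact: vMM.
Qed.

(** With t the Radon-Nikodym derivative of [f] relative to [zeta], 0 <= t <= 1, the vector [theta]
    is t zeta, and the second bound says t^2 <= t. It is proved without t: |pi a theta|^2 is the
    limit of the numbers f(a^* a s_k), and Cauchy-Schwarz gives N^4 <= N^2 f(a^* a) for N = |pi a
    theta|. *)
Lemma dominated_vector f : dominated f -> exists theta : K,
  (forall a, M a -> f a = inner (pi a zeta) theta) /\
  (forall a, M a -> nr (pi a theta) ^+ 2 <= complex.Re (f (adj a * a))).
Proof.
move=> fP; have fF := dominated_form fP; have sM := vn_subspace vM.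
have M1 := von_neumann1 vM.
have fCS a b : M a -> M b ->
    nr (f (adj b * a)) ^+ 2 <= nr (pi a zeta) ^+ 2 * complex.Re (f (adj b * b)).
  move=> Ma Mb; apply: (le_trans (psd_CS sM fF Ma Mb)).
  rewrite ler_wpM2r ?(dominated_le fP)//.
  by have := dominated_ge0 fP Mb; rewrite lecE => /andP[].
have [||||theta [s [Ms sth fE]]] := @riesz R K (bop H) M (fun a => pi a zeta) f
    (Num.sqrt (complex.Re (f 1))).
- exact: sM.
- by move=> c a b _ _; exact: repr_linv.
- exact: dominated_lin fP.
- move=> a Ma; have := fCS a 1 Ma M1; rewrite adj1 !mul1r => h.
  rewrite -(@ler_pXn2r _ 2) ?nnegrE ?mulr_ge0 ?nr_ge0 ?sqrtr_ge0//.
  rewrite exprMn sqr_sqrtr; first by rewrite mulrC.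
  by have := dominated_ge0 fP M1; rewrite adj1 mul1r lecE => /andP[].
exists theta; split=> // a Ma.
set N := nr (pi a theta); set t := complex.Re _.
have t0 : 0 <= t by have := dominated_ge0 fP Ma; rewrite lecE => /andP[].
have Mas k : M (a * s k) by exact: (vnM vM).
have c1 : (fun k => pi (a * s k) zeta) @ \oo --> pi a theta.
  under eq_fun do rewrite (reprM piP).
  by apply: (bl_cvg (bopP (pi a))).
have c2 : (fun k => nr (f (adj a * (a * s k))) ^+ 2) @ \oo --> (N ^+ 2) ^+ 2.
  have -> : N ^+ 2 = nr (inner (pi a theta) (pi a theta)).
    by rewrite inner_nr nrR ger0_norm// sqr_ge0.
  have c3 : (fun k => f (adj a * (a * s k)) : C^o) @ \oo -->
      (inner (pi a theta) (pi a theta) : C^o).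
    have -> : (fun k => f (adj a * (a * s k))) =
        (fun k => inner (pi (a * s k) zeta) (pi a theta)).
      apply/funext => k; rewrite fE; last exact: (vn_adjM vM).
      by rewrite (reprM piP) bopME (repr_adj piP) adjE'.
    exact: cvg_innerl.
  rewrite [X in _ --> X]expr2; under eq_fun do rewrite expr2.
  by apply: cvgM; exact: (cvg_nr c3).
have c4 : (fun k => nr (pi (a * s k) zeta) ^+ 2 * t) @ \oo --> N ^+ 2 * t.
  apply: cvgMr_tmp; rewrite [X in _ --> X]expr2; under eq_fun do rewrite expr2.
  by apply: cvgM; exact: cvg_nr.
have h : (N ^+ 2) ^+ 2 <= N ^+ 2 * t.
  by apply: (ler_cvg_to c2 c4); apply: nearW => k; exact: fCS.
have [->|N0] := eqVneq N 0; first by rewrite expr0n.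
rewrite -(@ler_pM2l _ (N ^+ 2)) ?exprn_gt0// lt_neqAle eq_sym N0; exact: nr_ge0.
Qed.

Definition rn_vector f : K := xget 0 [set theta |
  (forall a, M a -> f a = inner (pi a zeta) theta) /\
  (forall a, M a -> nr (pi a theta) ^+ 2 <= complex.Re (f (adj a * a)))].

Lemma rn_vectorP f : dominated f ->
  (forall a, M a -> f a = inner (pi a zeta) (rn_vector f)) /\
  (forall a, M a -> nr (pi a (rn_vector f)) ^+ 2 <= complex.Re (f (adj a * a))).
Proof.
move=> /dominated_vector[th hth]; rewrite /rn_vector.
by case: xgetP => [? _ //|/(_ th)].
Qed.

(** On Radon-Nikodym derivatives this is the map t |-> t - t^2. *)
Definition rn_step f a : C := f a - inner (pi a (rn_vector f)) (rn_vector f).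

Lemma rn_step_dominated f : dominated f -> dominated (rn_step f).
Proof.
move=> fP; have [h1 h2] := rn_vectorP fP.
have hE a : inner (pi (adj a * a) (rn_vector f)) (rn_vector f) =
    (nr (pi a (rn_vector f)) ^+ 2)%:C.
  by rewrite (reprM piP) (repr_adj piP) bopME adjE' inner_nr.
split=> [c a b Ma Mb|a Ma|a Ma]; rewrite /rn_step.
- by rewrite (dominated_lin fP)// repr_linv innerDl innerZl; ring.
- rewrite hE subr_ge0 lecE/=; have := dominated_ge0 fP Ma.
  by rewrite lecE => /andP[/eqP-> _]; rewrite eqxx h2.
- rewrite hE ReB (le_trans _ (dominated_le fP Ma))//= gerBl sqr_ge0//.
Qed.

(* Telescoping [t = (t - t^2) + t^2], iterated: no square root of the
   Radon-Nikodym derivative is needed. *)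
Lemma dominated_vector_state f : dominated f -> exists xi : l2 K,
  forall a, M a -> f a = inner (amp (pi a) xi) xi.
Proof.
move=> fP; pose g k := iter k rn_step f; pose th k := rn_vector (g k).
have gP k : dominated (g k).
  by elim: k => [//|k IH]; rewrite /g iterS; exact: rn_step_dominated.
have M1 := von_neumann1 vM.
have gE a n : f a = \sum_(0 <= k < n) inner (pi a (th k)) (th k) + g n a.
  elim: n => [|n IH]; first by rewrite big_geq// add0r.
  by rewrite IH big_nat_recr// -addrA; congr (_ + _); rewrite /g iterS /rn_step addrC subrK.
have thl2 : th \in @square_summable R K.
  apply/asboolP; exists (complex.Re (f 1)) => n.
  have -> : sqsum th n = complex.Re (f 1 - g n 1).
    rewrite (gE 1 n) addrK /sqsum (repr1 piP).
    elim: n => [|n IH]; first by rewrite !big_geq.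
    by rewrite !big_nat_recr// ReD IH bop1E inner_nr.
  rewrite ReB gerBl; have := dominated_ge0 (gP n) M1.
  by rewrite adj1 mul1r lecE => /andP[].
pose xi : l2 K := L2 thl2; exists xi => a Ma.
have th0 : th @ \oo --> (0 : K) by exact: (l2_cvg0 xi).
(* The remainder is itself represented by [th n], which tends to 0 as a term of a square-summable
   sequence. *)
have g0 : (fun n => g n a : C^o) @ \oo --> (0 : C^o).
  have -> : (fun n => g n a) = (fun n => inner (pi a zeta) (th n)).
    by apply/funext => n; rewrite (rn_vectorP (gP n)).1.
  by rewrite -(inner0r (pi a zeta)); exact: cvg_innerr.
have c1 : (fun n => \sum_(0 <= k < n) inner (pi a (th k)) (th k) + g n a : C^o) @ \oo -->
    (inner (amp (pi a) xi) xi + 0 : C^o).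
  exact: (cvgD (@inner_l2P R K (amp (pi a) xi) xi) g0).
rewrite -[RHS]addr0; apply: (lim_uniqC _ c1).
by apply: cvg_near_cst; apply: nearW => n; rewrite -gE.
Qed.

End RadonNikodym.

(** The three levels of [l2]: sequences of the ultraweak topology, the finite list of seminorms that
    controls [tau], and the summands of the telescoping series. *)
Lemma trace_vector_state (R : realType) (H : hilbertType R) (M : set (bop H))
    (tau : bop H -> R[i]^o) :
  von_neumann M -> faithful_normal_tracial_state M tau ->
  exists (K : hilbertType R) (pi : bop H -> bop K) (xi : K),
    amplification pi /\ forall a, M a -> tau a = inner (pi a xi) xi.
Proof.
move=> vM tauP; have [zeta hz] := trace_dominated vM tauP.
have [|xi hxi] := dominated_vector_state (@amp2_amplification R H) vM (zeta := zeta) (f := tau).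
  by split=> [||a Ma]; [exact: tau_lin tauP|exact: tau_ge0 tauP|exact: hz].
exists (l2 (l2 (l2 H))), (@amp R (l2 (l2 H)) \o (@amp R (l2 H) \o @amp R H)), xi.
split=> //; apply: comp_amplification; last exact: amp_amplification.
exact: amp2_amplification.
Qed.

(** * Bounded vectors and modular maps *)

Section BoundedVectors.
Context {R : realType} {H K : hilbertType R} (pi : bop H -> bop K) (xi : K).
Local Notation C := R[i].
Context (piP : amplification pi).
Implicit Types (M N : set (bop H)) (a b n T S : bop H).

(** The condition under which [pi n xi |-> n h] extends to a bounded modular operator from the
    closure of [N xi] to [H]. *)
Definition bounded_vector N (h : H) :=
  exists B : R, forall n, N n -> nr (n h) <= B * nr (pi n xi).

Definition contractive_vector N (h : H) :=
  forall n, N n -> nr (n h) <= nr (pi n xi).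

(** The closure of [N xi], which plays the role of L^2(N). *)
Definition cyclic_limit N (v : K) :=
  exists2 s : nat -> bop H, forall k, N (s k) & (fun k => pi (s k) xi) @ \oo --> v.

Lemma reprB S T : pi (S - T) = pi S - pi T.
Proof.
by rewrite addrC -scaleN1r (repr_lin piP) scaleN1r addrC.
Qed.

Lemma bounded_vector_subspace N : subspace_set (bounded_vector N).
Proof.
split; first by exists 0 => n _; rewrite bop0 nr0 mul0r.
move=> c h k [B hB] [D hD]; exists (nr c * B + D) => n Nn.
rewrite bopD bopZ (le_trans (nrD _ _))// nrZ mulrDl -mulrA lerD ?hD//.
by rewrite ler_wpM2l ?nr_ge0 ?hB.
Qed.

Lemma bounded_vector_commutant N h S : commutant N S -> bounded_vector N h ->
  bounded_vector N (S h).
Proof.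
move=> cS [B hB]; have [D D0 hD] := bl_bound (bopP S); exists (D * B) => n Nn.
rewrite -bopME -cS// bopME (le_trans (hD _))// -mulrA ler_wpM2l// hB//.
Qed.

Lemma bounded_vector_intertwiner N c : intertwiner pi c -> bounded_vector N (c xi).
Proof.
move=> [cP ci]; have [D D0 hD] := bl_bound cP; exists D => n _.
by rewrite -ci hD.
Qed.

(* The projection onto the closure of the bounded vectors commutes with the
   commutant of [M], hence lies in [M]; its complement kills [xi]. *)
Lemma bounded_vector_dense M : von_neumann M ->
  (forall a, M a -> pi a xi = 0 -> a = 0) ->
  forall h : H, exists2 s : nat -> H, forall k, bounded_vector M (s k) & s @ \oo --> h.
Proof.
move=> vM sep h.
have [P DP] := projection (bounded_vector_subspace M).
have MP : M P.
  apply: bicommutant => // S cS; apply: (projects_on_comm DP) => d.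
    exact: bounded_vector_commutant.
  by apply: bounded_vector_commutant; exact: commutant_adj.
suff P1 : 1 - P = 0.
  have [s Ds sh] := DP.1 h; exists s => //.
  by have -> : h = P h by rewrite -[LHS]bop1E -(subrK P 1) P1 add0r.
apply: sep; first by apply: (vnB vM) => //; exact: von_neumann1 vM.
apply: (repr_separated piP) => c ci; rewrite ci.2 bopBE bop1E.
by rewrite (projects_on_id DP) ?subrr//; exact: bounded_vector_intertwiner.
Qed.

Lemma contractive_vector_total M : von_neumann M ->
  (forall a, M a -> pi a xi = 0 -> a = 0) ->
  forall x, (forall h, contractive_vector M h -> inner h x = 0) -> x = 0.
Proof.
move=> vM sep x hx.
have hb h : bounded_vector M h -> inner h x = 0.
  move=> [B hB]; pose D := `|B| + 1.
  have D0 : 0 < D by rewrite ltr_wpDl.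
  have : inner (D^-1%:C *: h) x = 0.
    apply: hx => n Mn; rewrite bopZ nrZ nrR gtr0_norm ?invr_gt0// ler_pdivrMl//.
    rewrite (le_trans (hB _ Mn))// ler_wpM2r ?nr_ge0//.
    by rewrite (le_trans (ler_norm _))// lerDl.
  rewrite innerZl => /eqP; rewrite mulf_eq0 => /orP[|/eqP//].
  by rewrite -(rmorph0 (real_complex R)) (inj_eq (@complexI R)) invr_eq0 gt_eqF.
have [s Ms sx] := bounded_vector_dense vM sep x.
apply/eqP; rewrite -(@nr_eq0 R) -sqrf_eq0 -(inj_eq (@complexI R)) -inner_nr.
rewrite rmorph0; apply/eqP; apply: (lim_uniqC (cvg_innerl (y := x) sx)).
by apply: cvg_near_cst; apply: nearW => k; exact: hb.
Qed.

(** A subset of a separable metric space is separable: [e j l] is a contractive vector within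
    1/(l+1) of the dense point [d j] when there is one, and 0, which is contractive, otherwise. *)
Lemma countable_total M : separable H -> von_neumann M ->
  (forall a, M a -> pi a xi = 0 -> a = 0) ->
  exists2 eta : nat -> H, forall k, contractive_vector M (eta k) &
    forall x, (forall k, inner (eta k) x = 0) -> x = 0.
Proof.
move=> [D [/countable_injP[f finj] dD]] vM sep.
pose d (j : nat) : H := xget 0 [set x | D x /\ f x = j].
have dE x : D x -> d (f x) = x.
  move=> Dx; rewrite /d; case: xgetP => [y _ [Dy fy]|/(_ x)]; last by case.
  by apply: finj => //; exact/mem_set.
pose e (j l : nat) : H :=
  xget 0 [set h | contractive_vector M h /\ nr (h - d j) < l.+1%:R^-1].
have c0 : contractive_vector M 0 by move=> n _; rewrite bop0 nr0 nr_ge0.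
have eM j l : contractive_vector M (e j l).
  by rewrite /e; case: xgetP => [y _ []|].
exists (fun k => if unpickle k is Some (j, l) then e j l else 0).
  by move=> k; case: unpickle => // -[].
move=> x hx; have {}hx j l : inner (e j l) x = 0.
  by have := hx (pickle (j, l)); rewrite pickleK.
apply: (contractive_vector_total vM sep) => h Mh.
apply/eqP; rewrite -(@nr_eq0 R) eq_le nr_ge0 andbT; apply/ler_addgt0Pr => r r0.
rewrite add0r; have x1 : 0 < nr x + 1 by rewrite ltr_wpDl ?nr_ge0.
have r2 : 0 < r / (nr x + 1) / 2 by rewrite !divr_gt0.
have [l _ /(_ l (leqnn l)) hl] := near_infty_natSinv_lt (PosNum r2).
rewrite /= in hl.
have l0 : 0 < (l.+1%:R^-1 : R) by rewrite invr_gt0.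
have [y [yh Dy]] : ball h l.+1%:R^-1%:C `&` D !=set0.
  apply: dD; last by apply: ball_open; rewrite ltcR.
  by exists h; apply: ballxx; rewrite ltcR.
move: yh; rewrite -ball_normE /ball_/= nrE ltcR => yh.
(* [h] itself is a candidate, so the default 0 is not what [e (f y) l] returns. *)
have [hin] : [set h | contractive_vector M h /\ nr (h - d (f y)) < l.+1%:R^-1] (e (f y) l).
  rewrite /e; case: xgetP => [z _ //|/(_ h)]; case; split=> //.
  by rewrite dE.
rewrite dE// => hey.
have -> : inner h x = inner (h - e (f y) l) x by rewrite innerBl hx subr0.
rewrite (le_trans (inner_CS _ _))//.
have : nr (h - e (f y) l) <= r / (nr x + 1).
  rewrite -(subrKA y) (le_trans (nrD _ _))// (splitr (r / _)) lerD//.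
    exact: ltW (lt_trans yh hl).
  by rewrite nr_dist; exact: ltW (lt_trans hey hl).
move=> /(ler_wpM2r (nr_ge0 x))/le_trans; apply.
by rewrite -mulrA ler_piMr ?(ltW r0)// ler_pdivrMl// mulr1 lerDl.
Qed.

Section Cyclic.
Context N (vN : von_neumann N).

Lemma cyclic_limit_lin (c : C) v w : cyclic_limit N v -> cyclic_limit N w ->
  cyclic_limit N (c *: v + w).
Proof.
move=> [s Ns sv] [r Nr rw]; exists (fun k => c *: s k + r k).
  by move=> k; exact: (von_neumann_lin vN).
under eq_fun do rewrite repr_linv//.
by apply: cvgD => //; exact: cvgZl_tmp.
Qed.

Lemma cyclic_limit_repr n v : N n -> cyclic_limit N v -> cyclic_limit N (pi n v).
Proof.
move=> Nn [s Ns sv]; exists (fun k => n * s k); first by move=> k; exact: (vnM vN).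
under eq_fun do rewrite (reprM piP).
by apply: (bl_cvg (bopP (pi n))).
Qed.

Lemma cyclic_limit_ext v w : cyclic_limit N v -> cyclic_limit N w ->
  (forall n, N n -> inner (pi n xi) v = inner (pi n xi) w) -> v = w.
Proof.
move=> cv cw vw; apply/eqP; rewrite -subr_eq0.
have [s Ns sv] : cyclic_limit N (v - w).
  by rewrite addrC -scaleN1r; exact: cyclic_limit_lin.
rewrite -(@nr_eq0 R) -sqrf_eq0 -(inj_eq (@complexI R)) -inner_nr rmorph0; apply/eqP.
apply: (lim_uniqC (cvg_innerl (y := v - w) sv)).
by apply: cvg_near_cst; apply: nearW => k; rewrite innerBr vw// subrr.
Qed.

(** [A] is the adjoint of the contraction [pi n xi |-> n eta] from the closure of [N xi] to [H]. *)
Record module_map (eta : H) (A : H -> K) : Prop := {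
  module_map_lin : bounded_linear A ;
  module_map_le : forall h, nr (A h) <= nr h ;
  module_mapM : forall n h, N n -> A (n h) = pi n (A h) ;
  module_map_cyclic : forall h, cyclic_limit N (A h) ;
  module_map_inner : forall n h, N n -> inner (pi n xi) (A h) = inner (n eta) h }.

(** Riesz defines [A h] inside the closure of [N xi], where its inner products with [N xi] determine
    it; linearity and modularity are instances of this uniqueness. *)
Lemma module_map_exists eta : contractive_vector N eta ->
  exists A, module_map eta A.
Proof.
move=> Neta.
have /choice[A AP] : forall h, exists v : K, cyclic_limit N v /\
    forall n, N n -> inner (pi n xi) v = inner (n eta) h.
  move=> h; have [||||v [s [Ns sv vE]]] := @riesz R K (bop H) N (fun n => pi n xi)
    (fun n => inner (n eta) h) (nr h).
  - exact: vn_subspace.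
  - by move=> c a b _ _; exact: repr_linv.
  - by move=> c a b _ _; rewrite bopDE bopZE innerDl innerZl.
  - by move=> n Nn; rewrite (le_trans (inner_CS _ _))// mulrC ler_wpM2l ?nr_ge0 ?Neta.
  - by exists v; split; [exists s|move=> n Nn; rewrite -vE].
have Ale h : nr (A h) <= nr h.
  have [->|n0] := eqVneq (nr (A h)) 0; first exact: nr_ge0.
  have npos : 0 < nr (A h) by rewrite lt_neqAle eq_sym n0 nr_ge0.
  rewrite -(ler_pM2l npos) -expr2.
  have -> : nr (A h) ^+ 2 = nr (inner (A h) (A h)).
    by rewrite inner_nr nrR ger0_norm// sqr_ge0.
  have [[s Ns sA] Ain] := AP h.
  have c1 : (fun k => nr (inner (pi (s k) xi) (A h))) @ \oo -->
      nr (inner (A h) (A h)) by exact: (cvg_nr (cvg_innerl (y := A h) sA)).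
  have c2 : (fun k => nr (pi (s k) xi) * nr h) @ \oo --> nr (A h) * nr h.
    by apply: cvgMr_tmp; exact: cvg_nr.
  apply: (ler_cvg_to c1 c2); apply: nearW => k; rewrite Ain//.
  by rewrite (le_trans (inner_CS _ _))// ler_wpM2r ?nr_ge0 ?Neta.
exists A; split=> //.
- split=> [c x y|]; last by exists 1 => h; rewrite mul1r.
  apply: cyclic_limit_ext; [exact: (AP _).1|apply: cyclic_limit_lin; exact: (AP _).1|].
  by move=> n Nn; rewrite innerDr innerZr !(AP _).2// innerDr innerZr.
- move=> n h Nn; apply: cyclic_limit_ext.
  + exact: (AP _).1.
  + by apply: cyclic_limit_repr => //; exact: (AP _).1.
  move=> m Nm; rewrite (AP _).2// -[pi n]adjK -adjE -(repr_adj piP) -bopME -(reprM piP).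
  by rewrite (AP _).2 ?bopME ?adjE'//; exact: (vn_adjM vN).
- by move=> h; exact: (AP h).1.
- by move=> n h Nn; exact: (AP h).2.
Qed.

End Cyclic.

End BoundedVectors.

(** * Exhausting the identity by modular maps *)

Section Contractions.
Context {R : realType} {H : hilbertType R}.
Local Notation C := R[i].
Implicit Types P : bop H.

Definition positive_contraction P := psd_op P /\ psd_op (1 - P).

Lemma positive_contraction_nr P x : positive_contraction P ->
  nr (P x) ^+ 2 <= complex.Re (inner (P x) x).
Proof.
move=> [P0 P1].
have := psd_CS (subspace_setT H) (psd_op_form P0) (x := x) (y := P x) I I.
rewrite inner_nr nrR ger0_norm ?sqr_ge0// => h1.
have h2 : complex.Re (inner (P (P x)) (P x)) <= nr (P x) ^+ 2.
  have := P1 (P x); rewrite bopBE bop1E innerBl inner_nr lecE => /andP[_].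
  by rewrite ReB subr_ge0.
have h3 : 0 <= complex.Re (inner (P x) x) by have := P0 x; rewrite lecE => /andP[].
have [->|n0] := eqVneq (nr (P x)) 0; first by rewrite expr0n.
have n2 : 0 < nr (P x) ^+ 2 by rewrite exprn_gt0// lt_neqAle eq_sym n0 nr_ge0.
rewrite -(ler_pM2l n2) -expr2 (le_trans h1)// mulrC ler_wpM2r//.
Qed.

Lemma positive_contraction_le P x : positive_contraction P -> nr (P x) <= nr x.
Proof.
move=> pP; have h1 := positive_contraction_nr x pP.
have h2 := le_trans (ler_norm _) (le_trans (Re_nr _) (inner_CS (P x) x)).
have [->|n0] := eqVneq (nr (P x)) 0; first exact: nr_ge0.
have npos : 0 < nr (P x) by rewrite lt_neqAle eq_sym n0 nr_ge0.
by rewrite -(ler_pM2l npos) -expr2 (le_trans h1 h2).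
Qed.

End Contractions.

Lemma sum_CauchySchwarz (R : realType) (a b : nat -> R) n :
  (\sum_(0 <= k < n) a k * b k) ^+ 2 <=
  (\sum_(0 <= k < n) a k ^+ 2) * (\sum_(0 <= k < n) b k ^+ 2).
Proof.
apply: discriminant_le; first exact: sqr_ge0.
  by apply: sumr_ge0 => k _; exact: sqr_ge0.
move=> t; set s := \sum_(0 <= k < n) a k * b k.
have -> : \sum_(0 <= k < n) a k ^+ 2 + 2 * t * s ^+ 2 +
    t ^+ 2 * (s ^+ 2 * \sum_(0 <= k < n) b k ^+ 2) =
    \sum_(0 <= k < n) (a k + t * s * b k) ^+ 2.
  rewrite [RHS](eq_bigr (fun k => a k ^+ 2 + (2 * t * s) * (a k * b k) +
      (t ^+ 2 * s ^+ 2) * b k ^+ 2)) => [|k _]; last by ring.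
  by rewrite !big_split/= -!big_distrr/= -/s; ring.
by apply: sumr_ge0 => k _; exact: sqr_ge0.
Qed.

(** Only injectivity of [pickle] is available, so pigeonhole: the n+1 codes of (i, r), r <= n,
    cannot all lie below n. *)
Lemma unpickle_infinitely_often (i n : nat) :
  exists2 k, (n <= k)%N & exists r : nat, unpickle k = Some (i, r).
Proof.
have [//|h] := pselect (exists2 k, (n <= k)%N & exists r : nat, unpickle k = Some (i, r)).
have hlt (r : 'I_n.+1) : (pickle (i, nat_of_ord r) < n)%N.
  rewrite ltnNge; apply/negP => nr; apply: h.
  by exists (pickle (i, nat_of_ord r)) => //; exists r; rewrite pickleK.
pose g r := Ordinal (hlt r).
have ginj : injective g.
  move=> r r' /(congr1 val)/= /(pcan_inj pickleK)[].
  exact: val_inj.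
by have := leq_card g ginj; rewrite !card_ord ltnn.
Qed.

Section Exhaustion.
Context {R : realType} {H K : hilbertType R} (pi : bop H -> bop K) (xi : K).
Local Notation C := R[i].
Context (piP : amplification pi) (N : set (bop H)) (vN : von_neumann N).
Context (eta : nat -> H) (A : nat -> H -> K)
  (AP : forall k, module_map pi xi N (eta k) (A k)).
Context (eta_total : forall x, (forall k, inner (eta k) x = 0) -> x = 0).
Implicit Types (P : bop H) (x y h : H).

(** Q = P - V^* V with V = A_k P. Taking A_k P instead of A_k P^(1/2) avoids a square root and still
    keeps Q positive, since V^* V <= P^2 <= P. *)
Lemma remainder_step k P : positive_contraction P -> commutant N P ->
  exists Q, [/\ positive_contraction Q, commutant N Q &
    forall x y, inner (Q x) y = inner (P x) y - inner (A k (P x)) (A k (P y))].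
Proof.
move=> pP cP; have Al := module_map_lin (AP k).
have [B B0 hB] := bl_bound (bopP P).
have [||||Q QE] := @bop_form R H
    (fun x y => inner (P x) y - inner (A k (P x)) (A k (P y))) (B + B * B).
- by rewrite addr_ge0 ?mulr_ge0.
- by move=> a x x' y; rewrite bopD bopZ (Al.1) !innerDl !innerZl; ring.
- by move=> a x x' y; rewrite bopD bopZ (Al.1) !innerDr !innerZr; ring.
- move=> x y; rewrite (le_trans (nrB _ _))// !mulrDl lerD//.
    by rewrite (le_trans (inner_CS _ _))// ler_wpM2r ?nr_ge0.
  rewrite (le_trans (inner_CS _ _))// -mulrA mulrACA ler_pM ?nr_ge0//.
    by rewrite (le_trans (module_map_le (AP k) _)).
  by rewrite (le_trans (module_map_le (AP k) _)).
have Qle x : nr (A k (P x)) ^+ 2 <= complex.Re (inner (P x) x).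
  apply: le_trans (positive_contraction_nr x pP).
  by rewrite ler_pXn2r ?nnegrE ?nr_ge0// (module_map_le (AP k)).
have Im0 x : complex.Im (inner (P x) x) = 0 by exact: ger0_Im (pP.1 x).
exists Q; split=> //.
  split=> x.
    by rewrite QE inner_nr subr_ge0 lecE/= Im0 eqxx Qle.
  rewrite bopBE bop1E innerBl QE opprB addrCA inner_nr.
  by rewrite addr_ge0 ?ler0c ?sqr_ge0//; have := pP.2 x; rewrite bopBE innerBl.
move=> n Nn; apply: bop_ext => x; apply: inner_extl => y.
have cP' z : P (n z) = n (P z) by rewrite -!bopME cP.
rewrite !bopME QE cP' (module_mapM (AP k) _ Nn) [RHS]adjE QE.
have Nan : N (adj n) by exact: vn_adj.
have -> : P (adj n y) = adj n (P y) by rewrite -!bopME cP.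
by rewrite (module_mapM (AP k) _ Nan) (repr_adj piP) -!adjE.
Qed.

Lemma remainders : exists Q : nat -> bop H, [/\ Q 0 = 1,
  forall k, positive_contraction (Q k), forall k, commutant N (Q k) &
  forall k x y, inner (Q k.+1 x) y =
    inner (Q k x) y - inner (A k (Q k x)) (A k (Q k y))].
Proof.
have /choice[step stepP] : forall p : nat * bop H, exists Q,
    positive_contraction p.2 -> commutant N p.2 ->
    [/\ positive_contraction Q, commutant N Q & forall x y, inner (Q x) y =
      inner (p.2 x) y - inner (A p.1 (p.2 x)) (A p.1 (p.2 y))].
  move=> [k P] /=; have [pP|pP] := pselect (positive_contraction P); last by exists 0.
  have [cP|cP] := pselect (commutant N P); last by exists 0.
  by have [Q QP] := remainder_step k pP cP; exists Q.
pose Q := fix Q k := if k is k'.+1 then step (k', Q k') else 1 : bop H.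
have QP k : positive_contraction (Q k) /\ commutant N (Q k).
  elim: k => [|k [IH1 IH2]] /=; last by have [] := stepP (k, Q k) IH1 IH2.
  split; last by move=> n _; rewrite mul1r mulr1.
  split=> x; first by rewrite bop1E inner_nr ler0c sqr_ge0.
  by rewrite subrr bop0E inner0l.
exists Q; split=> // [k|k|k x y]; [exact: (QP k).1|exact: (QP k).2|].
by have [_ _ ->] := stepP (k, Q k) (QP k).1 (QP k).2.
Qed.

Context (Q : nat -> bop H) (Q0 : Q 0 = 1)
  (Qpos : forall k, positive_contraction (Q k)) (Qcomm : forall k, commutant N (Q k))
  (QS : forall k x y, inner (Q k.+1 x) y =
    inner (Q k x) y - inner (A k (Q k x)) (A k (Q k y))).

Lemma remainder_sum J x y : inner (Q J x) y =
  inner x y - \sum_(0 <= k < J) inner (A k (Q k x)) (A k (Q k y)).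
Proof.
elim: J => [|J IH]; first by rewrite Q0 big_geq// subr0.
by rewrite QS IH big_nat_recr//= opprD addrA.
Qed.

Lemma remainder_sqsum J x :
  \sum_(0 <= k < J) nr (A k (Q k x)) ^+ 2 <= nr x ^+ 2.
Proof.
have := (Qpos J).1 x; rewrite remainder_sum inner_nr lecE => /andP[_].
rewrite ReB subr_ge0; apply: le_trans.
rewrite le_eqVlt; apply/orP; left; apply/eqP.
elim: J => [|J IH]; first by rewrite !big_geq.
by rewrite !big_nat_recr//= ReD IH inner_nr.
Qed.

Lemma remainder_summand_cvg0 x : (fun k => nr (A k (Q k x))) @ \oo --> (0 : R).
Proof.
have l2x : (fun k => A k (Q k x)) \in @square_summable R K.
  by apply/asboolP; exists (nr x ^+ 2) => n; exact: remainder_sqsum.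
by rewrite -(@nr0 R K); exact: (cvg_nr (l2_cvg0 (L2 l2x))).
Qed.

Lemma remainder_diff_psd k l : (k <= l)%N -> psd_op (Q k - Q l).
Proof.
move=> kl x; rewrite bopBE innerBl -(subnKC kl).
elim: (l - k)%N => [|m IH]; first by rewrite addn0 subrr.
by rewrite addnS QS opprB addrCA addrC addr_ge0// inner_nr ler0c sqr_ge0.
Qed.

(** At the indices k with [eta k = eta i], the inner product of [eta k] with Q_k x is that of [xi]
    with A_k Q_k x, a term of a square-summable sequence. Between these indices the decreasing
    sequence <Q_k x, x> is Cauchy, and Cauchy-Schwarz for the positive operator Q_k - Q_l carries
    the smallness over to all later l. *)
Lemma remainder_weak_cvg0 i x : (forall n, exists2 k, (n <= k)%N & eta k = eta i) ->
  (fun k => inner (Q k x) (eta i) : C^o) @ \oo --> (0 : C^o).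
Proof.
move=> often.
pose a k := complex.Re (inner (Q k x) x).
have aS k l : (k <= l)%N -> a l <= a k.
  move=> kl; have := remainder_diff_psd kl x.
  by rewrite bopBE innerBl lecE => /andP[_]; rewrite ReB subr_ge0.
have acv : cvg (a @ \oo).
  apply: nonincreasing_is_cvgn; first by move=> k l; exact: aS.
  by exists 0 => _ [k _ <-]; have := (Qpos k).1 x; rewrite lecE => /andP[].
pose b := nr (eta i) ^+ 2 + 1.
have b0 : 0 < b by rewrite ltr_wpDl ?sqr_ge0.
have le1 k l : (k <= l)%N ->
    nr (inner ((Q k - Q l) x) (eta i)) ^+ 2 <= (a k - a l) * b.
  move=> kl; have := psd_CS (subspace_setT H) (psd_op_form (remainder_diff_psd kl))
    (x := x) (y := eta i) I I.
  move=> /le_trans; apply; rewrite [in X in X * _]bopBE innerBl ReB.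
  apply: ler_pM => //.
  - by rewrite subr_ge0 aS.
  - by have := remainder_diff_psd kl (eta i); rewrite lecE => /andP[].
  rewrite bopBE innerBl ReB /b.
  have h1 : 0 <= complex.Re (inner (Q l (eta i)) (eta i)).
    by have := (Qpos l).1 (eta i); rewrite lecE => /andP[].
  have h2 : complex.Re (inner (Q k (eta i)) (eta i)) <= nr (eta i) ^+ 2.
    have := (Qpos k).2 (eta i); rewrite bopBE bop1E innerBl inner_nr lecE => /andP[_].
    by rewrite ReB subr_ge0.
  by lra.
apply/cvg_nrP/cvgrPdist_lt => e e0.
have e2 : 0 < e / 2 by rewrite divr_gt0.
have e3 : 0 < (e / 2) ^+ 2 / b by rewrite divr_gt0// exprn_gt0.
have /cvgrPdist_lt/(_ _ e3)[n1 _ hn1] := acv.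
have c2 : (fun k => nr xi * nr (A k (Q k x))) @ \oo --> (0 : R).
  by rewrite -(mulr0 (nr xi)); apply: cvgMl_tmp; exact: remainder_summand_cvg0.
have /cvgrPdist_lt/(_ _ e2)[n2 _ hn2] := c2.
have [k nk ek] := often (maxn n1 n2).
have /andP[k1 k2] : (n1 <= k)%N && (n2 <= k)%N by rewrite -geq_max.
exists k => // l /= kl; rewrite sub0r normrN ger0_norm ?nr_ge0// subr0.
have -> : inner (Q l x) (eta i) = inner (Q k x) (eta i) - inner ((Q k - Q l) x) (eta i).
  by rewrite bopBE innerBl opprB addrC subrK.
rewrite (le_lt_trans (nrB _ _))// (splitr e) ltrD//.
  rewrite -ek inner_sym nr_conj.
  have -> : inner (eta k) (Q k x) = inner xi (A k (Q k x)).
    have := module_map_inner (AP k) (Q k x) (von_neumann1 vN).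
    by rewrite (repr1 piP) !bop1E.
  apply: (le_lt_trans (inner_CS _ _)); have := hn2 k k2.
  by rewrite /= sub0r normrN ger0_norm// mulr_ge0 ?nr_ge0.
rewrite -(@ltr_pXn2r _ 2) ?nnegrE ?nr_ge0 ?(ltW e2)//.
apply: (le_lt_trans (le1 _ _ kl)); rewrite -ltr_pdivlMr//.
have lima : limn a <= a l.
  by apply: nonincreasing_cvgn_ge => // m n; exact: aS.
have := hn1 k k1; rewrite /= distrC ger0_norm; last first.
  by rewrite subr_ge0; apply: nonincreasing_cvgn_ge => // m n; exact: aS.
by apply: le_lt_trans; rewrite lerD2l lerN2.
Qed.

End Exhaustion.

(** * Extending the conditional expectation *)

Lemma cauchy_transfer (R : realType) (H K : hilbertType R) (u : nat -> H) (v : nat -> K)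
    (x : H) (B : R) : u @ \oo --> x ->
  (forall k l, nr (v k - v l) <= B * nr (u k - u l)) ->
  exists y : K, v @ \oo --> y.
Proof.
move=> ux hB; apply: cauchy_nr_cvg => e e0; pose D := `|B| + 1.
have D0 : 0 < D by rewrite ltr_wpDl.
have [n0 hn0] := cvg_cauchy_nr ux (divr_gt0 e0 D0).
exists n0 => k l kn ln; apply: (le_lt_trans (hB k l)).
apply: (@le_lt_trans _ _ (D * nr (u k - u l))).
  by rewrite ler_wpM2r ?nr_ge0// (le_trans (ler_norm _))// lerDl.
by rewrite mulrC -ltr_pdivlMr// hn0.
Qed.

Section Expectation.
Context {R : realType} {H K : hilbertType R} (pi : bop H -> bop K) (xi : K).
Local Notation C := R[i].
Context (piP : amplification pi) (M : set (bop H)) (vM : von_neumann M).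
Hypothesis xi_tracial : forall a b, M a -> M b ->
  inner (pi (a * b) xi) xi = inner (pi (b * a) xi) xi.
Hypothesis xi_separating : forall a, M a -> pi a xi = 0 -> a = 0.

Lemma repr_inner S T v w : inner (pi S v) (pi T w) = inner (pi (adj T * S) v) w.
Proof. by rewrite (reprM piP) (repr_adj piP) bopME adjE'. Qed.

Lemma nr_repr_adj a : M a -> nr (pi (adj a) xi) = nr (pi a xi).
Proof.
move=> Ma; apply/eqP; rewrite -(@eqrXn2 _ 2) ?nr_ge0//.
rewrite -(inj_eq (@complexI R)) -!inner_nr !repr_inner adjK; apply/eqP.
by apply: xi_tracial => //; exact: (vn_adj vM).
Qed.

Section Subalgebra.
Context (N : set (bop H)) (vN : von_neumann N) (NM : N `<=` M).

(* [w], the projection of [x xi] onto the closure of [N xi], stands for the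
   conditional expectation of [x], which is not yet known to be bounded; hence
   the restriction to an [N]-bounded [v]. *)
Lemma conditional_limit x (n_ : nat -> bop H) (w v v' : K) (B : R) : M x ->
  (forall k, N (n_ k)) -> (fun k => pi (n_ k) xi) @ \oo --> w ->
  (forall n, N n -> inner (pi n xi) w = inner (pi n xi) (pi x xi)) ->
  cyclic_limit pi xi N v -> (forall n, N n -> nr (pi n v) <= B * nr (pi n xi)) ->
  cyclic_limit pi xi N v' ->
  (fun k => inner (pi (n_ k) v) v' : C^o) @ \oo --> (inner (pi x v) v' : C^o).
Proof.
move=> Mx Nn nw wx [s Ns sv] vB [r Nr rv'].
have [z nz] : exists z : K, (fun k => pi (n_ k) v) @ \oo --> z.
  apply: (cauchy_transfer (B := B) nw) => k l.
  by rewrite -!bopBE -!(reprB piP); apply: vB; exact: (vnB vN).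
(* Traciality makes [s |-> adj s] isometric on the vectors [pi s xi]; [y] is the image of [v] under
   the modular conjugation. *)
have [y sy] : exists y : K, (fun q => pi (adj (s q)) xi) @ \oo --> y.
  apply: (cauchy_transfer (B := 1) sv) => k l.
  rewrite -!bopBE -!(reprB piP) -adjB mul1r nr_repr_adj//.
  by apply: NM; exact: (vnB vN).
have repr_cvg a : (fun q => pi a (pi (s q) xi)) @ \oo --> pi a v.
  by apply: (bl_cvg (bopP (pi a))).
have key c : N c -> inner z (pi c xi) = inner (pi x v) (pi c xi).
  move=> Nc.
  have Nas q : N (c * adj (s q)) by apply: (vnM vN) => //; exact: (vn_adj vN).
  have cy : (fun q => pi (c * adj (s q)) xi) @ \oo --> pi c y.
    under eq_fun do rewrite (reprM piP).
    by apply: (bl_cvg (bopP (pi c))).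
  (* Both sides are traces, of c^* a s and of s c^* a: right multiplication by [s q] is moved to the
     other argument. *)
  have swap a q : M a ->
      inner (pi a (pi (s q) xi)) (pi c xi) = inner (pi a xi) (pi (c * adj (s q)) xi).
    move=> Ma; rewrite -bopME -(reprM piP) !repr_inner adjM adjK.
    rewrite mulrA xi_tracial ?mulrA//; last exact: NM.
    by apply: (vn_adjM vM) => //; exact: NM.
  have l1 : inner (pi x v) (pi c xi) = inner (pi x xi) (pi c y).
    apply: (lim_uniqC (cvg_innerl (y := pi c xi) (repr_cvg x))).
    by under eq_fun do rewrite swap//; exact: cvg_innerr.
  (* [pi c y] is a limit of vectors of [N xi], which cannot distinguish [x xi] from its projection
     [w]. *)
  have l2 : inner (pi x xi) (pi c y) = inner w (pi c y).
    apply: (lim_uniqC (cvg_innerr (y := pi x xi) cy)).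
    have -> : (fun q => inner (pi x xi) (pi (c * adj (s q)) xi)) =
        (fun q => inner w (pi (c * adj (s q)) xi)).
      by apply/funext => q; rewrite inner_sym -wx// -inner_sym.
    exact: cvg_innerr.
  rewrite l1 l2; apply: (lim_uniqC (cvg_innerl (y := pi c xi) nz)).
  have -> : (fun k => inner (pi (n_ k) v) (pi c xi)) =
      (fun k => inner (pi (n_ k) xi) (pi c y)).
    apply/funext => k; have Mnk := NM (Nn k).
    apply: (lim_uniqC (cvg_innerl (y := pi c xi) (repr_cvg (n_ k)))).
    by under eq_fun do rewrite swap//; exact: cvg_innerr.
  exact: cvg_innerl.
suff -> : inner (pi x v) v' = inner z v' by exact: cvg_innerl.
apply: (lim_uniqC (cvg_innerr (y := pi x v) rv')).
have -> : (fun k => inner (pi x v) (pi (r k) xi)) = (fun k => inner z (pi (r k) xi)).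
  by apply/funext => k; rewrite key.
exact: cvg_innerr.
Qed.

Context (eta : nat -> H) (A : nat -> H -> K)
  (AP : forall k, module_map pi xi N (eta k) (A k)).
Context (Q : nat -> bop H) (Q0 : Q 0 = 1)
  (Qpos : forall k, positive_contraction (Q k)) (Qcomm : forall k, commutant N (Q k))
  (QS : forall k x y, inner (Q k.+1 x) y =
    inner (Q k x) y - inner (A k (Q k x)) (A k (Q k y))).

Let V k x := A k (Q k x).

Definition partial_form (J : nat) (T : bop H) (x y : H) : C^o :=
  \sum_(0 <= k < J) inner (pi T (V k x)) (V k y).

Lemma VlinE k (c : C) x y : V k (c *: x + y) = c *: V k x + V k y.
Proof. by rewrite /V bopD bopZ (module_map_lin (AP k)).1. Qed.

Lemma Vmod k n x : N n -> V k (n x) = pi n (V k x).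
Proof. by move=> Nn; rewrite /V -bopME Qcomm// bopME (module_mapM (AP k) _ Nn). Qed.

(** The bound is uniform in [J] because sum |V_k x|^2 <= |x|^2; this is what makes the forms
    converge along an ultrafilter. *)
Lemma nr_partial_form J (T : bop H) x y (B : R) : 0 <= B -> (forall z, nr (T z) <= B * nr z) ->
  nr (partial_form J T x y) <= B * nr x * nr y.
Proof.
move=> B0 hB.
have h1 : nr (partial_form J T x y) <=
    B * \sum_(0 <= k < J) nr (V k x) * nr (V k y).
  rewrite /partial_form big_distrr/=; elim: J => [|J IH].
    by rewrite !big_geq// nr0.
  rewrite !big_nat_recr//= (le_trans (nrD _ _))// lerD// (le_trans (inner_CS _ _))//.
  by rewrite mulrA ler_wpM2r ?nr_ge0// (repr_bound piP).
apply: (le_trans h1); rewrite -mulrA ler_wpM2l//.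
rewrite -(@ler_pXn2r _ 2) ?nnegrE ?mulr_ge0 ?nr_ge0//; last first.
  by apply: sumr_ge0 => k _; rewrite mulr_ge0 ?nr_ge0.
rewrite (le_trans (sum_CauchySchwarz _ _ _))// exprMn.
have sqV z := remainder_sqsum Q0 Qpos QS J z.
by apply: ler_pM; [apply: sumr_ge0 => k _; exact: sqr_ge0|
  apply: sumr_ge0 => k _; exact: sqr_ge0|exact: sqV|exact: sqV].
Qed.

Lemma partial_form_linT J (c : C) S T x y :
  partial_form J (c *: S + T) x y = c * partial_form J S x y + partial_form J T x y.
Proof.
rewrite /partial_form big_distrr -big_split/=; apply: eq_bigr => k _.
by rewrite repr_linv// innerDl innerZl.
Qed.

Lemma partial_form_linl J (c : C) T x x' y :
  partial_form J T (c *: x + x') y = c * partial_form J T x y + partial_form J T x' y.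
Proof.
rewrite /partial_form big_distrr -big_split/=; apply: eq_bigr => k _.
by rewrite VlinE bopD bopZ innerDl innerZl.
Qed.

Lemma partial_form_linr J (c : C) T x y y' :
  partial_form J T x (c *: y + y') = c^* * partial_form J T x y + partial_form J T x y'.
Proof.
rewrite /partial_form big_distrr -big_split/=; apply: eq_bigr => k _.
by rewrite VlinE innerDr innerZr.
Qed.

Lemma partial_form1 J x y : partial_form J 1 x y = inner x y - inner (Q J x) y.
Proof.
rewrite (remainder_sum Q0 QS) opprB addrC subrK; apply: eq_bigr => k _.
by rewrite (repr1 piP) bop1E.
Qed.

Lemma partial_form_mull J n T x y : N n ->
  partial_form J (n * T) x y = partial_form J T x (adj n y).
Proof.
move=> Nn; apply: eq_bigr => k _.
by rewrite (@Vmod k (adj n) y (vn_adj vN Nn)) (reprM piP) bopME (repr_adj piP) adjE.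
Qed.

Lemma partial_form_mulr J n T x y : N n ->
  partial_form J (T * n) x y = partial_form J T (n x) y.
Proof. by move=> Nn; apply: eq_bigr => k _; rewrite (@Vmod k n x Nn) (reprM piP). Qed.

Lemma partial_form_ge0 J T x : 0 <= partial_form J (adj T * T) x x.
Proof.
apply: sumr_ge0 => k _; rewrite -repr_inner inner_nr ler0c; exact: sqr_ge0.
Qed.

Context (U : set_system nat) (FU : UltraFilter U)
  (Q_cvg0 : forall x y, (fun k => inner (Q k x) y : C^o) @ U --> (0 : C^o)).

Lemma partial_form1_cvg x y :
  (fun J => partial_form J 1 x y) @ U --> (inner x y : C^o).
Proof.
have h : (fun J => inner x y - inner (Q J x) y : C^o) @ U --> (inner x y - 0 : C^o).
  by apply: cvgB; [exact: cvg_cst|exact: Q_cvg0].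
by rewrite subr0 in h; under eq_fun do rewrite partial_form1.
Qed.

Lemma compression_exists : exists Phi : bop H -> bop H, forall T x y,
  (fun J => partial_form J T x y) @ U --> (inner (Phi T x) y : C^o).
Proof.
suff /choice[Phi PhiE] : forall T : bop H, exists S : bop H, forall x y,
    (fun J => partial_form J T x y) @ U --> (inner (S x) y : C^o) by exists Phi.
move=> T; have [B B0 hB] := bl_bound (bopP T).
have Fcv x y : (fun J => partial_form J T x y) @ U -->
    (lim ((fun J => partial_form J T x y) @ U) : C^o).
  apply: (ultra_cvgC (B := B * nr x * nr y)).
  by apply: nearW => J; exact: nr_partial_form.
have [||||S SE] := @bop_form R H (fun x y => lim ((fun J => partial_form J T x y) @ U)) B.
- by [].
- move=> a x x' y; apply: (lim_uniqC (Fcv _ _)).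
  under eq_fun do rewrite partial_form_linl.
  by apply: cvgD => //; exact: cvgMl_tmp.
- move=> a x y y'; apply: (lim_uniqC (Fcv _ _)).
  under eq_fun do rewrite partial_form_linr.
  by apply: cvgD => //; exact: cvgMl_tmp.
- move=> x y; apply: (cvgr_to_le (cvg_nr (Fcv x y))).
  by apply: nearW => J; exact: nr_partial_form.
- by exists S => x y; rewrite SE.
Qed.

Context (Phi : bop H -> bop H) (PhiE : forall T x y,
  (fun J => partial_form J T x y) @ U --> (inner (Phi T x) y : C^o)).

Lemma Phi_lin (c : C) S T : Phi (c *: S + T) = c *: Phi S + Phi T.
Proof.
apply: bop_ext => x; apply: inner_extl => y; apply: (lim_uniqC (@PhiE _ _ _)).
under eq_fun do rewrite partial_form_linT.
by rewrite bopDE bopZE innerDl innerZl; apply: cvgD => //; exact: cvgMl_tmp.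
Qed.

Lemma Phi1 : Phi 1 = 1.
Proof.
apply: bop_ext => x; apply: inner_extl => y; apply: (lim_uniqC (@PhiE _ _ _)).
exact: partial_form1_cvg.
Qed.

Lemma Phi_psd T : psd_op (Phi (adj T * T)).
Proof.
by move=> x; apply: (limC_ge0 _ (@PhiE _ _ _)); apply: nearW => J; exact: partial_form_ge0.
Qed.

Lemma Phi_mull n T : N n -> Phi (n * T) = n * Phi T.
Proof.
move=> Nn; apply: bop_ext => x; apply: inner_extl => y; apply: (lim_uniqC (@PhiE _ _ _)).
rewrite bopME adjE; under eq_fun do rewrite partial_form_mull//.
exact: PhiE.
Qed.

Lemma Phi_mulr n T : N n -> Phi (T * n) = Phi T * n.
Proof.
move=> Nn; apply: bop_ext => x; apply: inner_extl => y; apply: (lim_uniqC (@PhiE _ _ _)).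
rewrite bopME; under eq_fun do rewrite partial_form_mulr//.
exact: PhiE.
Qed.

(** On a bounded vector h the limit z of [n_ k h] exists, and [conditional_limit] with modularity
    gives <x V_k h, V_k y> = lim_l <V_k n_l h, V_k y> = <V_k z, V_k y> for each k. Summing over k
    and using sum V_k^* V_k = 1 yields Phi x h = z. *)
Lemma Phi_conditional x : M x -> exists w : K, exists2 n_ : nat -> bop H,
  forall k, N (n_ k) &
  [/\ (fun k => pi (n_ k) xi) @ \oo --> w,
    forall n, N n -> inner (pi n xi) w = inner (pi n xi) (pi x xi) &
    forall h, bounded_vector pi xi N h -> (fun k => n_ k h) @ \oo --> Phi x h].
Proof.
move=> Mx.
have [||||w [n_ [Nn nw wE]]] := @riesz R K (bop H) N (fun n => pi n xi)
    (fun n => inner (pi n xi) (pi x xi)) (nr (pi x xi)).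
- exact: (vn_subspace vN).
- by move=> c a b _ _; exact: repr_linv.
- by move=> c a b _ _; rewrite repr_linv// innerDl innerZl.
- by move=> n _; rewrite mulrC inner_CS.
exists w, n_ => //; split=> // [n Nn'|h [B hB]]; first by rewrite wE.
have [z nz] : exists z : H, (fun k => n_ k h) @ \oo --> z.
  apply: (cauchy_transfer (B := B) nw) => k l.
  by rewrite -!bopBE -!(reprB piP); apply: hB; exact: (vnB vN).
suff -> : Phi x h = z by [].
apply: inner_extl => y; apply: (lim_uniqC (@PhiE _ _ _)).
have -> : (fun J => partial_form J x h y) = (fun J => partial_form J 1 z y).
  apply/funext => J; apply: eq_bigr => k _.
  rewrite (repr1 piP) bop1E.
  have Vbl : bounded_linear (V k).
    by apply: bl_comp (bopP (Q k)) (module_map_lin (AP k)).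
  have c1 : (fun l => inner (pi (n_ l) (V k h)) (V k y) : C^o) @ \oo -->
      (inner (pi x (V k h)) (V k y) : C^o).
    apply: (conditional_limit (B := B) Mx Nn nw); last 3 first.
    - exact: (module_map_cyclic (AP k)).
    - move=> n Nn'; rewrite -(@Vmod k n h Nn'); apply: le_trans (hB n Nn').
      rewrite (le_trans (module_map_le (AP k) _))//.
      exact: positive_contraction_le.
    - exact: (module_map_cyclic (AP k)).
    - by move=> n Nn'; rewrite wE.
  apply: (lim_uniqC c1); under eq_fun => l do rewrite -(@Vmod k (n_ l) h (Nn l)).
  by apply: cvg_innerl; apply: (bl_cvg Vbl).
exact: partial_form1_cvg.
Qed.

(** On bounded vectors [Phi x] is a pointwise limit of elements of [N], so it commutes there with
    the commutant of [N]. Vectors bounded for [M] are bounded for [N] and dense, and [Phi x] is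
    bounded, so the bicommutant theorem applies. *)
Lemma Phi_range x : M x -> N (Phi x).
Proof.
move=> Mx; have [w [n_ Nn [nw wE nPhi]]] := Phi_conditional Mx.
apply: bicommutant => // S cS; apply: bop_ext => h; rewrite !bopME.
have [s Ms sh] := bounded_vector_dense piP vM xi_separating h.
have bN k : bounded_vector pi xi N (s k).
  by have [B hB] := Ms k; exists B => n Nn'; apply: hB; exact: NM.
have c1 : (fun k => Phi x (S (s k))) @ \oo --> Phi x (S h).
  by apply: (bl_cvg (bopP (Phi x))); apply: (bl_cvg (bopP S)).
apply: (lim_uniq c1).
have -> : (fun k => Phi x (S (s k))) = (fun k => S (Phi x (s k))).
  apply/funext => k.
  apply: (lim_uniq (nPhi _ (bounded_vector_commutant cS (bN k)))).
  have -> : (fun l => n_ l (S (s k))) = (fun l => S (n_ l (s k))).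
    by apply/funext => l; rewrite -!bopME cS.
  by apply: (bl_cvg (bopP S)); exact: nPhi.
by apply: (bl_cvg (bopP S)); apply: (bl_cvg (bopP (Phi x))).
Qed.

(** Every intertwiner sends [xi] to a bounded vector, on which [Phi x] is the limit of the [n_ k];
    as intertwiners separate points, Phi x xi = w, and [w] is paired with [xi]. *)
Lemma Phi_trace x : M x -> inner (pi (Phi x) xi) xi = inner (pi x xi) xi.
Proof.
move=> Mx; have [w [n_ Nn [nw wE nPhi]]] := Phi_conditional Mx.
have -> : pi (Phi x) xi = w.
  apply/eqP; rewrite -subr_eq0; apply/eqP; apply: (repr_separated piP) => c ci.
  rewrite (blB ci.1) ci.2; apply/eqP; rewrite subr_eq0; apply/eqP.
  have c1 := nPhi _ (bounded_vector_intertwiner xi N ci).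
  apply: (lim_uniq c1).
  have -> : (fun k => n_ k (c xi)) = (fun k => c (pi (n_ k) xi)).
    by apply/funext => k; rewrite ci.2.
  exact: (bl_cvg ci.1).
have := wE 1 (von_neumann1 vN); rewrite (repr1 piP) !bop1E => h.
by rewrite inner_sym h -inner_sym.
Qed.

End Subalgebra.

Lemma expectation_extends (N : set (bop H)) : separable H -> von_neumann N -> N `<=` M ->
  exists Phi : bop H -> bop H,
  [/\ forall (c : C) S T, Phi (c *: S + T) = c *: Phi S + Phi T,
    Phi 1 = 1 /\ (forall T, psd_op (Phi (adj T * T))),
    forall n T, N n -> Phi (n * T) = n * Phi T,
    forall n T, N n -> Phi (T * n) = Phi T * n &
    forall x, M x -> N (Phi x) /\ inner (pi (Phi x) xi) xi = inner (pi x xi) xi].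
Proof.
move=> sH vN NM.
have [e eM etot] := countable_total piP sH vM xi_separating.
(* The second component of the code is a counter that makes each [e i] recur infinitely often, as
   [remainder_weak_cvg0] requires. *)
pose eta k := if (unpickle k : option (nat * nat)) is Some (i, _) then e i else 0.
have eta_often i : forall n, exists2 k, (n <= k)%N & eta k = e i.
  move=> n; have [k nk [r kr]] := unpickle_infinitely_often i n.
  by exists k => //; rewrite /eta kr.
have etaN k : contractive_vector pi xi N (eta k).
  move=> n Nn; rewrite /eta; case: unpickle => [[i _]|]; first exact: (eM i n (NM _ Nn)).
  by rewrite bop0 nr0 nr_ge0.
have /choice[A AP] : forall k, exists A, module_map pi xi N (eta k) A.
  by move=> k; exact: module_map_exists.
have [Q [Q0 Qpos Qcomm QS]] := remainders piP vN AP.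
have [U [FU subU]] := ultraFilterLemma (eventually_filter : ProperFilter (\oo : set_system nat)).
have nrQ k x y : nr (inner (Q k x) y) <= nr x * nr y.
  by rewrite (le_trans (inner_CS _ _))// ler_wpM2r ?nr_ge0// positive_contraction_le.
have Qcv x y : (fun k => inner (Q k x) y : C^o) @ U -->
    (lim ((fun k => inner (Q k x) y : C^o) @ U) : C^o).
  by apply: (ultra_cvgC (B := nr x * nr y)); apply: nearW => k.
(* [remainder_weak_cvg0] tests against the [e i] only. Passing to the weak limit [S] of the [Q k]
   lets totality of the [e i] give S = 0, hence convergence to 0 against every vector. *)
have [||||S SE] := @bop_form R H (fun x y => lim ((fun k => inner (Q k x) y : C^o) @ U)) 1.
- by [].
- move=> a x x' y; apply: (lim_uniqC (@Qcv _ _)).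
  under eq_fun do rewrite bopD bopZ innerDl innerZl.
  by apply: cvgD => //; exact: cvgMl_tmp.
- move=> a x y y'; apply: (lim_uniqC (@Qcv _ _)).
  under eq_fun do rewrite innerDr innerZr.
  by apply: cvgD => //; exact: cvgMl_tmp.
- move=> x y; rewrite mul1r; apply: (cvgr_to_le (cvg_nr (Qcv x y))).
  exact: nearW.
have S0 x : S x = 0.
  apply: etot => i; rewrite inner_sym SE.
  have [i' _ i'E] := eta_often i 0.
  have Q0U : (fun k => inner (Q k x) (e i) : C^o) @ U --> (0 : C^o).
    have := remainder_weak_cvg0 piP vN AP Q0 Qpos QS (i := i') x.
    rewrite i'E => /(_ (eta_often i)) h W /h; exact: subU.
  by rewrite (lim_uniqC (Qcv x (e i)) Q0U) rmorph0.
have Q0U x y : (fun k => inner (Q k x) y : C^o) @ U --> (0 : C^o).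
  by have := Qcv x y; rewrite -SE S0 inner0l.
have [Phi PhiE] := compression_exists AP Q0 Qpos QS FU.
exists Phi; split.
- exact: (Phi_lin FU PhiE).
- by split; [exact: (Phi1 Q0 QS FU Q0U PhiE)|exact: (Phi_psd FU PhiE)].
- exact: (Phi_mull vN AP Qcomm FU PhiE).
- exact: (Phi_mulr AP Qcomm FU PhiE).
- move=> x Mx; split.
    exact: (Phi_range vN NM AP Q0 Qpos Qcomm QS FU Q0U PhiE Mx).
  exact: (Phi_trace vN NM AP Q0 Qpos Qcomm QS FU Q0U PhiE Mx).
Qed.

End Expectation.

(** * Limits of hypertraces *)

Section AmenableLimits.
Context {R : realType} {H : hilbertType R}.
Local Notation C := R[i].
Implicit Types (M N : set (bop H)) (tau : bop H -> C^o).

(** The constant in [norm_bounded] is complex; on a nonzero vector the inequality itself forces it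
    to be real. *)
Lemma nr_bop_bound (T_ : nat -> bop H) : norm_bounded T_ ->
  exists2 B : R, 0 <= B & norm_bounded_by B T_.
Proof.
move=> [B hB]; exists (nr B); first exact: nr_ge0.
move=> n x; rewrite -lecR -nrE (le_trans (hB n x))// rmorphM/= -!nrE.
have [->|x0] := eqVneq x 0; first by rewrite normr0 !mulr0.
have Breal : B \is Num.real.
  have : 0 <= B * `|x| by rewrite (le_trans _ (hB n x)).
  by rewrite pmulr_lge0 ?normr_gt0//; exact: ger0_real.
by rewrite ler_wpM2r// real_ler_norm.
Qed.

Lemma linear_of_fun (f : bop H -> C^o) :
  (forall (c : C) S T, f (c *: S + T) = c * f S + f T) ->
  exists phi : {linear bop H -> C^o}, forall T, phi T = f T.
Proof.
move=> fl; have fl' : linear f by move=> c S T; exact: fl.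
pose phi : {linear bop H -> C^o} := HB.pack_for {linear bop H -> C^o} f
  (GRing.isLinear.Build C (bop H) C^o *:%R f fl').
by exists phi.
Qed.

Lemma amenable_extension M tau N : separable H -> von_neumann M ->
  faithful_normal_tracial_state M tau -> von_neumann N -> N `<=` M ->
  amenable tau N ->
  exists psi : {linear bop H -> C^o}, [/\ is_state psi,
    forall x, M x -> psi x = tau x & forall n T, N n -> psi (T * n) = psi (n * T)].
Proof.
move=> sH vM tauP vN NM [phi [phiS phiN phiC]].
have [K [pi [xi [piP tauE]]]] := trace_vector_state vM tauP.
have xi_tr a b : M a -> M b -> inner (pi (a * b) xi) xi = inner (pi (b * a) xi) xi.
  move=> Ma Mb; rewrite -!tauE; [exact: (tau_tracial tauP)|exact: (vnM vM)|exact: (vnM vM)].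
have xi_sep a : M a -> pi a xi = 0 -> a = 0.
  move=> Ma a0; apply: (tau_faithful tauP) => //.
  rewrite tauE; last exact: (vn_adjM vM).
  by rewrite (reprM piP) bopME a0 bop0 inner0l.
have [Phi [Plin [P1 Ppsd] Pl Pr PM]] := expectation_extends piP vM xi_tr xi_sep sH vN NM.
have [|psi psiE] := @linear_of_fun (fun T => phi (Phi T)).
  by move=> c S T; rewrite Plin linearP.
exists psi; split.
- split=> [T|]; last by rewrite psiE P1 phiS.2.
  (* [Phi (adj T * T)] is known to be positive only through its quadratic form, not as a product of
     an adjoint with its operator. *)
  by rewrite psiE; apply: state_psd_ge0.
- move=> x Mx; have [Nx tx] := PM x Mx.
  by rewrite psiE phiN// tauE ?tx -?tauE//; exact: NM.
- by move=> n T Nn; rewrite !psiE (Pl n T Nn) (Pr n T Nn) phiC.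
Qed.

Lemma state_mul_le (phi : {linear bop H -> C^o}) S T : is_state phi ->
  nr (phi (S * T)) ^+ 2 <= complex.Re (phi (S * adj S)) * complex.Re (phi (adj T * T)).
Proof.
move=> phiP.
have := psd_CS (subspace_setT _) (state_form phiP) (x := T) (y := adj S) I I.
by rewrite adjK mulrC.
Qed.

(** As [tau] is a vector state of a multiple of the identity representation, bounded strong
    convergence on [H] is transported to the vector [xi] by [repr_sot]. *)
Lemma trace_sot M tau : von_neumann M -> faithful_normal_tracial_state M tau ->
  forall (B : R) (m_ : nat -> bop H), 0 <= B -> (forall n, M (m_ n)) ->
    norm_bounded_by B m_ -> (forall x, (fun n => m_ n x) @ \oo --> (0 : H)) ->
  (fun n => complex.Re (tau (adj (m_ n) * m_ n))) @ \oo --> (0 : R).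
Proof.
move=> vM tauP B m_ B0 Mm mB m0.
have [K [pi [xi [piP tauE]]]] := trace_vector_state vM tauP.
have pi0 := repr_sot piP B0 mB m0 xi.
have -> : (fun n => complex.Re (tau (adj (m_ n) * m_ n))) =
    (fun n => nr (pi (m_ n) xi) * nr (pi (m_ n) xi)).
  apply/funext => n; rewrite tauE; last exact: (vn_adjM vM).
  by rewrite (reprM piP) bopME (repr_adj piP) adjE' inner_nr expr2.
by rewrite -(mulr0 0) -(@nr0 R K); apply: cvgM; exact: cvg_nr.
Qed.

Lemma amenable_limit M tau (N_ : nat -> set (bop H)) N (U : set_system nat) :
  von_neumann M -> faithful_normal_tracial_state M tau ->
  UltraFilter U -> \oo `<=` U ->
  (forall n, N_ n `<=` M) -> N `<=` M ->
  (forall x, N x -> exists x_ : nat -> bop H,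
    [/\ forall n, N_ n (x_ n), norm_bounded x_ & strong_star_cvg x_ x]) ->
  (\forall n \near U, exists psi : {linear bop H -> C^o}, [/\ is_state psi,
    forall x, M x -> psi x = tau x &
    forall m T, N_ n m -> psi (T * m) = psi (m * T)]) ->
  amenable tau N.
Proof.
move=> vM tauP FU subU NnM NM lim_N am.
have [psi psiP] : exists psi : nat -> {linear bop H -> C^o}, \forall n \near U,
    [/\ is_state (psi n), forall x, M x -> psi n x = tau x &
      forall m T, N_ n m -> psi n (T * m) = psi n (m * T)].
  (* Indices without a suitable state receive the arbitrary functional [psi0]; they are negligible
     along [U]. *)
  have [n0 [psi0 _]] := filter_ex am.
  have /choice[psi hpsi] : forall n, exists psi : {linear bop H -> C^o},
      (exists psi : {linear bop H -> C^o}, [/\ is_state psi,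
        forall x, M x -> psi x = tau x &
        forall m T, N_ n m -> psi (T * m) = psi (m * T)]) ->
      [/\ is_state psi, forall x, M x -> psi x = tau x &
        forall m T, N_ n m -> psi (T * m) = psi (m * T)].
    move=> n; have [[psi hp]|np] := pselect (exists psi : {linear bop H -> C^o},
      [/\ is_state psi, forall x, M x -> psi x = tau x &
        forall m T, N_ n m -> psi (T * m) = psi (m * T)]); first by exists psi.
    by exists psi0.
  by exists psi; apply: filterS am => n /hpsi.
have psicv T : (fun n => psi n T) @ U --> (lim ((fun n => psi n T) @ U) : C^o).
  have [B B0 hB] := bl_bound (bopP T).
  apply: (ultra_cvgC (B := B)); apply: filterS psiP => n [sp _ _].
  exact: state_le1.
have [|phi phiE] := @linear_of_fun (fun T => lim ((fun n => psi n T) @ U)).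
  move=> c S T; apply: (lim_uniqC (psicv _)).
  under eq_fun do rewrite linearP.
  by apply: cvgD => //; exact: cvgMl_tmp.
have phicv T : (fun n => psi n T) @ U --> (phi T : C^o) by rewrite phiE.
have phiS : is_state phi.
  split=> [T|].
    by apply: (limC_ge0 _ (phicv _)); apply: filterS psiP => n [sp _ _]; exact: sp.1.
  apply: (lim_uniqC (phicv 1)); apply: cvg_near_cst.
  by apply: filterS psiP => n [sp _ _]; exact: sp.2.
exists phi; split=> // [m Nm|m T Nm].
  apply: (lim_uniqC (phicv m)); apply: cvg_near_cst.
  by apply: filterS psiP => n [_ h _]; rewrite h//; exact: NM.
have [x_ [Nx xB xm]] := lim_N m Nm.
have [B B0 hB] := nr_bop_bound xB.
have [D D0 hD] := bl_bound (bopP m).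
pose d n := m - x_ n.
have Md n : M (d n) by apply: (vnB vM); [exact: NM|exact: (NnM n)].
have dB : norm_bounded_by (D + B) d.
  by move=> n x; rewrite bopBE (le_trans (nrB _ _))// mulrDl lerD.
have d0 x : (fun n => d n x) @ \oo --> (0 : H).
  rewrite -(subrr (m x)); apply: cvgB; first exact: cvg_cst.
  exact: (xm x).1.
have tau0 := trace_sot vM tauP (addr_ge0 D0 B0) Md dB d0.
have [E E0 hE] := bl_bound (bopP T).
have E'hE : forall x, nr (adj T x) <= E * nr x by exact: nr_adj.
have small (f : nat -> C) :
    (\forall n \near U, nr (f n) ^+ 2 <= (E * E) * complex.Re (tau (adj (d n) * d n))) ->
    (fun n => f n : C^o) @ U --> (0 : C^o).
  move=> fle; apply/cvg_nrP/cvgrPdist_lt => e e0.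
  have c0 : (fun n => (E * E) * complex.Re (tau (adj (d n) * d n))) @ U --> (0 : R).
    rewrite -(mulr0 (E * E)); apply: cvgMl_tmp => W /tau0; exact: subU.
  have /cvgrPdist_lt/(_ _ (exprn_gt0 2 e0)) := c0; apply: filterS2 fle => n h1 h2.
  rewrite sub0r normrN subr0 ger0_norm ?nr_ge0//.
  rewrite -(@ltr_pXn2r _ 2) ?nnegrE ?nr_ge0 ?(ltW e0)//; apply: (le_lt_trans h1).
  by move: h2; rewrite sub0r normrN; exact: le_lt_trans (ler_norm _).
have bnd n (S : bop H) : is_state (psi n) -> (forall x, nr (S x) <= E * nr x) ->
    0 <= complex.Re (psi n (adj S * S)) <= E * E.
  move=> sp hS; apply/andP; split.
    by have := sp.1 S; rewrite lecE => /andP[].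
  apply: (le_trans (ler_norm _)); apply: (le_trans (Re_nr _)).
  apply: state_le1 => // [|x]; first by rewrite mulr_ge0.
  by rewrite bopME (le_trans (nr_adj E0 hS _))// -mulrA ler_wpM2l.
(* For the product [d n * T], Cauchy-Schwarz produces [d d^*]; traciality turns it into the [d^* d]
   that [trace_sot] controls. *)
have tauC n : tau (d n * adj (d n)) = tau (adj (d n) * d n).
  by apply: (tau_tracial tauP) => //; exact: (vn_adj vM).
have s1 : (fun n => psi n (T * d n) : C^o) @ U --> (0 : C^o).
  apply: small; apply: filterS psiP => n [sp pt _].
  rewrite (le_trans (state_mul_le _ _ sp))// [psi n (adj (d n) * d n)]pt; last exact: (vn_adjM vM).
  have := bnd n _ sp E'hE; rewrite adjK => /andP[h1 h2].
  rewrite ler_wpM2r//.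
  by have := tau_ge0 tauP (Md n); rewrite lecE => /andP[].
have s2 : (fun n => psi n (d n * T) : C^o) @ U --> (0 : C^o).
  apply: small; apply: filterS psiP => n [sp pt _].
  rewrite (le_trans (state_mul_le _ _ sp))// [psi n (d n * adj (d n))]pt; last first.
    by apply: (vnM vM) => //; exact: (vn_adj vM).
  rewrite tauC mulrC.
  have := bnd n _ sp hE => /andP[h1 h2].
  rewrite ler_wpM2r//.
  by have := tau_ge0 tauP (Md n); rewrite lecE => /andP[].
have e1 : (fun n => psi n (T * m) - psi n (T * d n) : C^o) @ U --> (phi (T * m) - 0 : C^o).
  exact: (cvgB (phicv (T * m)) s1).
have e2 : (fun n => psi n (m * T) - psi n (d n * T) : C^o) @ U --> (phi (m * T) - 0 : C^o).
  exact: (cvgB (phicv (m * T)) s2).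
rewrite !subr0 in e1 e2; apply: (lim_uniqC e1).
(* [m - d n] is [x_ n], an element of [N_ n], with which [psi n] is central. *)
have eqn : \forall n \near U, psi n (T * m) - psi n (T * d n) =
    psi n (m * T) - psi n (d n * T).
  apply: filterS psiP => n [_ _ pc].
  rewrite -!linearB /d !mulrBr !mulrBl !opprB !(addrC (_ * _) (_ - _)) !subrK.
  exact: pc.
apply: cvg_trans e2; apply: near_eq_cvg.
by apply: filterS eqn => n ->.
Qed.

End AmenableLimits.

Theorem proposition4p7 (R : realType) (H : hilbertType R)
    (H_separable : separable H)
    (M : set (bop H)) (M_von_neumann : von_neumann M)
    (tau : bop H -> R[i]) (tauP : faithful_normal_tracial_state M tau) :
  closed [set N : SA M | amenable tau N].
Proof.
rewrite -[X in closed X]setCK; apply: open_closedC.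
(* Openness unfolds to a statement on sequences: those converging to a nonamenable algebra are
   eventually nonamenable. *)
have : EM_open (~` [set N : SA M | amenable tau N]); last by [].
move=> N_ N /= Nam [liminfN _].
have [//|nN] := pselect (\forall n \near \oo, (~` [set N : SA M | amenable tau N]) (N_ n)).
exfalso; apply: Nam.
pose A := [set n | amenable tau (N_ n)].
(* The amenable indices are cofinal, so [\oo] restricted to them is proper; an ultrafilter above it
   replaces the passage to a subsequence. *)
have PF : ProperFilter (within A (\oo : set_system nat)).
  apply: Build_ProperFilter_ex => B [n0 _ hB].
  apply: contrapT => nB; apply: nN; exists n0 => // n n0n An.
  by apply: nB; exists n; exact: hB.
have [U [FU subU]] := ultraFilterLemma PF.
have subU' : \oo `<=` U.
  by move=> B [n0 _ hB]; apply: subU; exists n0 => // n n0n _; exact: hB.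
have UA : U A by apply: subU; exists 0.
apply: (@amenable_limit _ _ M tau (fun n => N_ n) N U) => //.
- by move=> n; exact: SA_sub.
- exact: SA_sub.
- by move=> x; rewrite -liminfN => -[].
- apply: filterS UA => n An.
  exact: (amenable_extension H_separable M_von_neumann tauP (SA_von_neumann (N_ n)) (@SA_sub _ _ _ (N_ n)) An).
Qed.
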